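(* Let $X$ be a finite, irreducible 2-complex. The following are equivalent: (i) $\rho_+(X)=1$; (ii) $\sigma_+(X)=1$; (iii) $X$ is not concise.
   Context: **Complexes and maps.** A 2-complex $X$ (not assumed connected) is a graph $X_{(1)}$ (the 1-skeleton, with vertex set $V_X$ and edge set $E_X$) together with 2-cells (called faces, forming a set $F_X$) attached along combinatorial loops (circles mapping to $X_{(1)}$), which are assumed to be immersions, i.e. locally injective. A branched 2-complex is a 2-complex with a map $\mathrm{Area}:F_X\to\mathbb{Z}_{>0}$; $\mathrm{Area}(X)=\sum_{f}\mathrm{Area}(f)$ is required to be $>0$. A 2-complex with no specified areas is regarded as a branched 2-complex in which every face has area 1 (a ''standard'' 2-complex). A map (branched morphism) $\phi:Y\to X$ of branched 2-complexes sends vertices to vertices, edges homeomorphically to edges, and faces to faces, each face $f$ being mapped by a map modelled on $z\mapsto z^m$ on the unit disc for some integer $m=m_\phi(f)\geq 1$, subject to $\mathrm{Area}(f)=m_\phi(f)\,\mathrm{Area}(\phi(f))$. A branched immersion is a map that is injective on the link of every vertex. **Essential maps.** A map $\phi:Y\to X$ of finite branched 2-complexes is folded as $Y\xrightarrow{\phi_0}\bar Y\xrightarrow{\bar\phi}X$: here $\bar Y_{(1)}\to X_{(1)}$ is the immersion of graphs obtained from $Y_{(1)}\to X_{(1)}$ by Stallings folds, and the faces of $\bar Y$ are those components of the fibre product of $\bar Y_{(1)}$ with the attaching circles of the faces of $X$ through which the attaching circle of some face of $Y$ factors; thus $\bar\phi$ is a branched immersion. The map $\phi$ is essential if (i) $\phi_0:Y_{(1)}\to\bar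 Y_{(1)}$ is a homotopy equivalence, and (ii) $\phi_0$ restricts to a homeomorphism on the interiors of faces (it is a bijection on faces, with all multiplicities 1; equivalently $\phi_0$ preserves area). It is an essential equivalence if moreover $\bar\phi$ is an isomorphism. **Irreducibility.** A 2-complex is visibly reducible if its 1-skeleton has a vertex of valence 0 or 1, or some vertex is locally separating, or it has a free face (an edge hit exactly once by exactly one face). It is visibly irreducible if it is not visibly reducible and every essential equivalence $X'\to X$ is an isomorphism. A finite (branched) 2-complex $X$ is irreducible if there is an essential equivalence $X'\to X$ with $X'$ visibly irreducible; otherwise it is reducible. A finite 2-complex is a surface if its realisation is a closed topological surface, i.e. every vertex link is a circle. **Curvature.** For a finite branched 2-complex $Y$ put $\chi(Y_{(1)})=\#V_Y-\#E_Y$, $\tau(Y)=\mathrm{Area}(Y)+\chi(Y_{(1)})$ and $\kappa(Y)=\tau(Y)/\mathrm{Area}(Y)$. Let $\mathrm{Irred}(X)$ be the set of essential maps $Y\to X$ with $Y$ a finite, irreducible branched 2-complex, and $\mathrm{Surf}(X)$ the set of essential maps $Y\to X$ with $Y$ a (branched) closed surface. Then $\rho_+(X)=\sup_{Y\in\mathrm{Irred}(X)}\kappa(Y)$ and $\sigma_+(X)=\sup_{Y\in\mathrm{Surf}(X)}\kappa(Y)$, with value $-\infty$ if the relevant set is empty. **Concise.** A 2-complex is concise unless it has either two 2-cells with (freely) homotopic attaching maps (as unoriented loops in the 1-skeleton) or a single 2-cell whose boundary is a proper power. Equivalently, for connected $X$ whose face boundaries represent $w_1,\dots,w_n\in\pi_1(X_{(1)})$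 (up to conjugacy and inversion), the family $\{\langle w_1\rangle,\dots,\langle w_n\rangle\}$ is malnormal: $g\langle w_i\rangle g^{-1}\cap\langle w_j\rangle$ is trivial unless $i=j$ and $g\in\langle w_i\rangle$.
   Formalization: In ''visibly irreducible'', the condition that every essential equivalence X' → X is an isomorphism is only required for X' without vertices of valence 0 or 1; otherwise folding an added spike onto an edge would leave no complex visibly irreducible. *)

(* Defs.v *)
(* MathComp + MathComp-Analysis (the latter only for suprema in \bar R).      *)
From HB Require Import structures.
From mathcomp Require Import all_boot all_order all_algebra.
From mathcomp Require Import boolp classical_sets reals constructive_ereal ereal.

Set Implicit Arguments.
Unset Strict Implicit.
Unset Printing Implicit Defensive.

Import Order.TTheory GRing.Theory Num.Theory.

(** ** Finite graphs *)

(* Serre's convention: a dart is an oriented edge, [inv d] is the same edge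
   with the opposite orientation. *)
Record graph := Graph {
  vertex : finType;
  dart : finType;
  src : dart -> vertex;
  inv : dart -> dart;
  invK : involutive inv;
  inv_neq : forall d, inv d != d }.

Definition tgt (G : graph) (d : dart G) : vertex G := src (inv d).

Definition edges (G : graph) : {set {set dart G}} :=
  [set [set d; inv d] | d : dart G].

(* A loop contributes 2 to the valence of its vertex. *)
Definition valence (G : graph) (v : vertex G) : nat := #|[set d | src d == v]|.

Definition same_component (G : graph) : rel (dart G) :=
  connect [rel d d' | (src d == src d') || (d' == inv d)].

Record graph_map (A B : graph) := GraphMap {
  gm_vertex : vertex A -> vertex B;
  gm_dart :> dart A -> dart B;
  gm_src : forall d, src (gm_dart d) = gm_vertex (src d);
  gm_inv : forall d, gm_dart (inv d) = inv (gm_dart d) }.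

Definition immersion (A B : graph) (f : graph_map A B) : Prop :=
  forall d d', src d = src d' -> f d = f d' -> d = d'.

Definition is_comp (A B C : graph) (f : graph_map A C)
    (f0 : graph_map A B) (f1 : graph_map B C) : Prop :=
  (forall v, gm_vertex f v = gm_vertex f1 (gm_vertex f0 v)) /\
  (forall d, f d = f1 (f0 d)).

Section FibreProduct.
Variables (A B C : graph) (f : graph_map A C) (g : graph_map B C).

Definition fib_vertex : finType :=
  {p : vertex A * vertex B | gm_vertex f p.1 == gm_vertex g p.2}.
Definition fib_dart : finType := {p : dart A * dart B | f p.1 == g p.2}.

Fact fib_src_subproof (p : fib_dart) :
  gm_vertex f (src (val p).1) == gm_vertex g (src (val p).2).
Proof. by rewrite -!gm_src (eqP (valP p)). Qed.
Definition fib_src (p : fib_dart) : fib_vertex :=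
  exist _ (src (val p).1, src (val p).2) (fib_src_subproof p).

Fact fib_inv_subproof (p : fib_dart) :
  f (inv (val p).1) == g (inv (val p).2).
Proof. by rewrite !gm_inv (eqP (valP p)). Qed.
Definition fib_inv (p : fib_dart) : fib_dart :=
  exist _ (inv (val p).1, inv (val p).2) (fib_inv_subproof p).

Fact fib_invK : involutive fib_inv.
Proof. by move=> [[a b] h]; apply: val_inj; rewrite /= !invK. Qed.
Fact fib_inv_neq p : fib_inv p != p.
Proof.
apply/eqP => /(congr1 (fun q : fib_dart => (val q).1)) /= /eqP.
by rewrite (negbTE (inv_neq _)).
Qed.

Definition fibre_product : graph := Graph fib_src fib_invK fib_inv_neq.
End FibreProduct.

(** ** Edge paths and homotopy *)

Fixpoint walk (G : graph) (u : vertex G) (p : seq (dart G)) (v : vertex G)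
    : bool :=
  if p is d :: q then (src d == u) && walk (tgt d) q v else u == v.

Definition path_inv (G : graph) (p : seq (dart G)) : seq (dart G) :=
  rev [seq inv d | d <- p].

(* Homotopy rel endpoints, generated by inserting and deleting backtracks. It
   is only used on walks; as deleting backtracks turns walks into walks, the
   intermediate words need not be required to be walks. *)
Inductive path_homotopic (G : graph) : seq (dart G) -> seq (dart G) -> Prop :=
| ph_backtrack p q d : path_homotopic (p ++ [:: d; inv d] ++ q) (p ++ q)
| ph_refl p : path_homotopic p p
| ph_sym p q : path_homotopic p q -> path_homotopic q p
| ph_trans p q r :
    path_homotopic p q -> path_homotopic q r -> path_homotopic p r.

Definition freely_homotopic (G : graph) (p q : seq (dart G)) : Prop :=
  exists u v r, [/\ walk u p u, walk v q v, walk u r v &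
    path_homotopic p (r ++ q ++ path_inv r)].

Definition proper_power (G : graph) (p : seq (dart G)) : Prop :=
  exists u q n, [/\ walk u p u, walk u q u, 1 < n &
    path_homotopic p (flatten (nseq n q))].

(* Up to homotopy, a continuous map between graphs is given by the images of
   the vertices, and of the edges as edge paths; a homotopy between two such
   maps is given, up to homotopy, by the tracks [h v] of the vertices. *)
Definition maps_homotopic (A B : graph)
    (fv gv : vertex A -> vertex B) (fd gd : dart A -> seq (dart B)) : Prop :=
  exists h : vertex A -> seq (dart B),
    (forall v, walk (fv v) (h v) (gv v)) /\
    (forall d, path_homotopic (fd d ++ h (tgt d)) (h (src d) ++ gd d)).

Definition homotopy_equivalence (A B : graph) (f : graph_map A B) : Prop :=
  exists (gv : vertex B -> vertex A) (gd : dart B -> seq (dart A)),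
    [/\ forall d, walk (gv (src d)) (gd d) (gv (tgt d)),
        forall d, gd (inv d) = path_inv (gd d),
        maps_homotopic (fun v => gv (gm_vertex f v)) id
          (fun d => gd (f d)) (fun d => [:: d]) &
        maps_homotopic (fun v => gm_vertex f (gv v)) id
          (fun d => [seq f e | e <- gd d]) (fun d => [:: d])].

(** ** Stallings folding *)

Inductive fold_vertex (A B : graph) (f : graph_map A B)
    : vertex A -> vertex A -> Prop :=
| fold_refl v : fold_vertex f v v
| fold_sym u v : fold_vertex f u v -> fold_vertex f v u
| fold_trans u v w :
    fold_vertex f u v -> fold_vertex f v w -> fold_vertex f u w
| fold_step d d' :
    fold_vertex f (src d) (src d') -> f d = f d' ->
    fold_vertex f (tgt d) (tgt d').

(* A -> C -> B is the factorization of [f] through the graph C obtained from A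
   by repeatedly identifying darts with the same origin and the same image;
   this determines it up to a unique isomorphism. *)
Definition stallings_folding (A B C : graph) (f : graph_map A B)
    (f0 : graph_map A C) (f1 : graph_map C B) : Prop :=
  [/\ is_comp f f0 f1, immersion f1,
      (forall w, exists v, gm_vertex f0 v = w) /\
      (forall e, exists d, f0 d = e),
      forall u v, gm_vertex f0 u = gm_vertex f0 v <-> fold_vertex f u v &
      forall d d', f0 d = f0 d' <->
        fold_vertex f (src d) (src d') /\ f d = f d'].

(** ** Finite branched 2-complexes *)

(* [bdry] is the disjoint union of the attaching circles: it is a graph all of
   whose vertices have valence 2, and the faces index its components. A vertex
   of [bdry] is thus a corner of a face. *)
Record complex := Complex {
  skel : graph;
  bdry : graph;
  face : finType;
  face_of : dart bdry -> face;
  att : graph_map bdry skel;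
  area : face -> nat;
  bdry_circles : forall c : vertex bdry, valence c = 2;
  face_of_component :
    forall b b', face_of b = face_of b' <-> same_component b b';
  face_of_surj : forall f, exists b, face_of b = f;
  att_immersion : immersion att;
  area_gt0 : forall f, 0 < area f;
  total_area_gt0 : 0 < \sum_f area f }.

Definition total_area (X : complex) : nat := \sum_(f : face X) area f.

Definition standard (X : complex) : Prop := forall f : face X, area f = 1.

(* Twice the length of the attaching circle: both orientations are counted. *)
Definition perimeter (X : complex) (f : face X) : nat :=
  #|[set b | face_of b == f]|.

(* An immersion of circles is a covering, so each face is mapped by a map
   modelled on z |-> z ^ m; [mor_perimeter] determines m = [mor_mult]. *)
Record morphism (Y X : complex) := Morphism {
  mor_skel : graph_map (skel Y) (skel X);
  mor_bdry : graph_map (bdry Y) (bdry X);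
  mor_face : face Y -> face X;
  mor_mult : face Y -> nat;
  mor_bdry_immersion : immersion mor_bdry;
  mor_att : forall b, mor_skel (att Y b) = att X (mor_bdry b);
  mor_face_of : forall b, face_of (mor_bdry b) = mor_face (face_of b);
  mor_perimeter :
    forall f, perimeter f = mor_mult f * perimeter (mor_face f);
  mor_area : forall f, area f = mor_mult f * area (mor_face f) }.

Definition isomorphism (Y X : complex) (phi : morphism Y X) : Prop :=
  [/\ bijective (gm_vertex (mor_skel phi)), bijective (mor_skel phi),
      bijective (gm_vertex (mor_bdry phi)), bijective (mor_bdry phi) &
      bijective (mor_face phi)].

(** ** Essential maps *)

(* The last two clauses say that the faces of Z are the components of the fibre
   product of skel Z with the attaching circles of X through which the
   attaching circle of some face of Y factors. *)
Definition folding (Y X Z : complex) (phi : morphism Y X)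
    (phi0 : morphism Y Z) (phi1 : morphism Z X) : Prop :=
  [/\ stallings_folding (mor_skel phi) (mor_skel phi0) (mor_skel phi1),
      is_comp (mor_bdry phi) (mor_bdry phi0) (mor_bdry phi1),
      injective (fun b => (att Z b, mor_bdry phi1 b)) &
      forall p : dart (fibre_product (mor_skel phi1) (att X)),
        (exists b, val p = (att Z b, mor_bdry phi1 b)) <->
        (exists (b : dart (bdry Y))
                (q : dart (fibre_product (mor_skel phi1) (att X))),
           val q = (mor_skel phi0 (att Y b), mor_bdry phi b) /\
           same_component q p)].

Definition essential_folding (Y X Z : complex) (phi : morphism Y X)
    (phi0 : morphism Y Z) (phi1 : morphism Z X) : Prop :=
  [/\ folding phi phi0 phi1,
      homotopy_equivalence (mor_skel phi0),
      bijective (mor_face phi0) &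
      forall f, mor_mult phi0 f = 1].

Definition essential (Y X : complex) (phi : morphism Y X) : Prop :=
  exists (Z : complex) (phi0 : morphism Y Z) (phi1 : morphism Z X),
    essential_folding phi phi0 phi1.

Definition essential_equivalence (Y X : complex) (phi : morphism Y X) : Prop :=
  exists (Z : complex) (phi0 : morphism Y Z) (phi1 : morphism Z X),
    essential_folding phi phi0 phi1 /\ isomorphism phi1.

(** ** Links and irreducibility *)

(* The link of v has a vertex for each dart d with [src d = v] and an edge for
   each corner c with [att c = v], joining the images of the two darts of the
   attaching circles that start at c. *)
Definition link_adj (X : complex) : rel (dart (skel X)) :=
  fun d d' => [exists b : dart (bdry X), exists b' : dart (bdry X),
    [&& b != b', src b == src b', att X b == d & att X b' == d']].

Definition link_degree (X : complex) (d : dart (skel X)) : nat :=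
  #|[set b | att X b == d]|.

Definition link_disconnected (X : complex) (v : vertex (skel X)) : Prop :=
  exists d d', [/\ src d = v, src d' = v & ~~ connect (@link_adj X) d d'].

(* A vertex separates its star exactly when its link is disconnected. *)
Definition locally_separating (X : complex) (v : vertex (skel X)) : Prop :=
  link_disconnected v.

(* A circle is a nonempty connected graph with all valences equal to 2; links
   have no loops because attaching maps are immersions. *)
Definition link_is_circle (X : complex) (v : vertex (skel X)) : Prop :=
  [/\ exists d, src d = v, ~ link_disconnected v &
      forall d, src d = v -> link_degree d = 2].

Definition surface (X : complex) : Prop :=
  forall v : vertex (skel X), link_is_circle v.

(* Sides of faces on the edge of d correspond to darts of [bdry] over d. *)
Definition free_edge (X : complex) (d : dart (skel X)) : Prop :=
  #|[set b | att X b == d]| = 1.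

Definition low_valence (X : complex) : Prop :=
  exists v : vertex (skel X), valence v <= 1.

Definition visibly_reducible (X : complex) : Prop :=
  [\/ low_valence X,
      exists v : vertex (skel X), locally_separating v |
      exists d : dart (skel X), free_edge d].

(* X' ranges over complexes without vertices of valence 0 or 1. Otherwise no
   complex would be visibly irreducible: attaching to X an extra edge by one
   endpoint, and folding this edge onto an edge of X, is an essential
   equivalence which is not an isomorphism. *)
Definition visibly_irreducible (X : complex) : Prop :=
  ~ visibly_reducible X /\
  forall (X' : complex) (phi : morphism X' X),
    ~ low_valence X' -> essential_equivalence phi -> isomorphism phi.

Definition irreducible (X : complex) : Prop :=
  exists (X' : complex) (phi : morphism X' X),
    essential_equivalence phi /\ visibly_irreducible X'.

(** ** Concise complexes *)

(* s runs once around the attaching circle of f, in either direction. *)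
Definition boundary_cycle (X : complex) (f : face X) (s : seq (dart (bdry X)))
    : Prop :=
  [/\ s != [::],
      ucycle [rel b b' | (src b' == tgt b) && (b' != inv b)] s &
      forall b, b \in s -> face_of b = f].

Definition concise (X : complex) : Prop :=
  ~ ((exists (f f' : face X) (s s' : seq (dart (bdry X))),
        [/\ f <> f', boundary_cycle f s, boundary_cycle f' s' &
            freely_homotopic (map (att X) s) (map (att X) s')]) \/
     (exists (f : face X) (s : seq (dart (bdry X))),
        boundary_cycle f s /\ proper_power (map (att X) s))).

(** ** Curvature *)

Local Open Scope ring_scope.

Definition euler_skel (X : complex) : int :=
  #|vertex (skel X)|%:Z - #|edges (skel X)|%:Z.

Definition tau (X : complex) : int := (total_area X)%:Z + euler_skel X.

Definition kappa (R : realType) (X : complex) : R :=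
  (tau X)%:~R / (total_area X)%:R.

Definition rho_plus (R : realType) (X : complex) : \bar R :=
  ereal_sup [set x : \bar R | exists (Y : complex) (phi : morphism Y X),
    [/\ essential phi, irreducible Y & x = (kappa R Y)%:E]]%classic.

Definition sigma_plus (R : realType) (X : complex) : \bar R :=
  ereal_sup [set x : \bar R | exists (Y : complex) (phi : morphism Y X),
    [/\ essential phi, surface Y & x = (kappa R Y)%:E]]%classic.

(* Main.v *)
From mathcomp Require Import all_boot all_order all_algebra.
From mathcomp Require Import boolp classical_sets reals constructive_ereal ereal.
From mathcomp Require Import zify.
Require Import Defs.

Set Implicit Arguments.
Unset Strict Implicit.
Unset Printing Implicit Defensive.

Import Order.TTheory GRing.Theory Num.Theory.

(** The equivalences follow from five facts.

    First, curvature is at most 1 on irreducible complexes. The visibly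
    irreducible model W of an irreducible complex Y has no vertex of valence less
    than 2, so the Euler characteristic of its 1-skeleton is at most 0. The same
    holds for Y, because the 1-skeleta are homotopy equivalent: for the
    combinatorial notion of homotopy equivalence this is the Hopf trace formula
    ([trace_formula], [homotopy_equivalence_euler]).

    Second, surfaces are irreducible ([surface_irreducible]), so that sigma_+ is
    at most rho_+. If W -> Y is an essential equivalence onto a surface, then
    modulo 2 the sum of the faces of Y is a cycle, and so is the sum of the faces
    of W, a homotopy equivalence of graphs being injective on cycles
    ([even_lift]). Hence the two sides of each edge of Y lift to a single edge of
    W, and the edges of W that have sides form a copy of Y. Comparing Euler
    characteristics and components shows that there is nothing else in W
    ([all_sides]).

    Third, there is a gap below 1 when X is concise ([area_gap]). Let W be the
    visibly irreducible model of Y, where Y -> X is essential. Each edge of W has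
    at least two sides of faces. Along a segment of W, a path through vertices of
    valence 2, these sides run together and read periodic words of X. Two periodic
    words which agree for as long as a common multiple of their periods agree for
    ever, and conciseness then makes the two sides equal ([concise_separates]).
    So the segments of W have bounded length ([short_segments]), and the number
    of its edges, hence the area of Y, is bounded by a multiple of minus the
    Euler characteristic that depends on X only.

    Fourth, if X is not concise then it has two different sides of faces that read
    the same word around circles of the same length ([not_concise_twins]):
    attaching words are cyclically reduced, so they are equal up to rotation when
    they are freely homotopic, and invariant under a nontrivial rotation when they
    are proper powers ([conjugate_rot], [proper_power_rot]).

    Fifth, gluing two discs with this boundary word along their boundary gives a
    sphere, and the two sides define an essential map from it to X
    ([sphere_map_essential]). Its 1-skeleton is a circle, so its curvature is 1. *)

(** * Reduced words and conjugation *)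

Lemma rot_comp (T : Type) i j (s : seq T) : exists k, rot i (rot j s) = rot k s.
Proof.
have [Hi|/ltnW Hi] := leqP i (size s); last first.
  by rewrite (@rot_oversize _ i) ?size_rot //; exists j.
have [Hj|/ltnW Hj] := leqP j (size s); last first.
  by rewrite (@rot_oversize _ j) //; exists i.
by rewrite rot_add_mod //; eexists.
Qed.

Section Words.
Variable G : graph.
Implicit Types (p q r s : seq (dart G)) (x y d : dart G).

(** The relation between consecutive darts of a reduced word. A word p is
   reduced when [sorted no_backtrack p], and cyclically reduced when
   [cycle no_backtrack p]. *)
Definition no_backtrack : rel (dart G) := fun x y => y != inv x.
Arguments no_backtrack _ _ /.

(** [push x s] is the reduced form of [x :: s] when s is reduced. *)
Definition push x s := if s is y :: s' then if y == inv x then s' else x :: s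
                       else [:: x].

(** Free reduction. *)
Definition reduce p := foldr push [::] p.

Lemma sorted_push x s : sorted no_backtrack s -> sorted no_backtrack (push x s).
Proof.
case: s => [|y s] //= Hs; case: ifP => [_|/negbT Hy]; first exact: path_sorted Hs.
by rewrite /= Hy.
Qed.

Lemma sorted_reduce p : sorted no_backtrack (reduce p).
Proof. by elim: p => //= x p; apply: sorted_push. Qed.

Lemma reduce_id p : sorted no_backtrack p -> reduce p = p.
Proof.
elim: p => //= x p IH Hp; rewrite IH; last exact: path_sorted Hp.
by case: p Hp {IH} => //= y p /andP[/negbTE ->].
Qed.

Lemma push_inv x s : sorted no_backtrack s -> push x (push (inv x) s) = s.
Proof.
case: s => [|y s] /=; first by rewrite eqxx.
case: ifP => [/eqP-> Hs|_ _]; last by rewrite /= eqxx.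
rewrite invK; case: s Hs => //= z s; rewrite invK => /andP[/negbTE].
by rewrite /= => ->.
Qed.

(** The normal form theorem for free groupoids: free reduction is a homotopy
   invariant, because [push x] and [push (inv x)] are mutually inverse on
   reduced words. *)
Lemma reduce_homotopic p q : path_homotopic p q -> reduce p = reduce q.
Proof.
elim=> {p q} [p q d|//|//|p q r _ -> _ ->//].
rewrite /reduce !foldr_cat /= push_inv //; exact: sorted_reduce.
Qed.

Lemma homotopic_reduced p q : sorted no_backtrack p -> sorted no_backtrack q ->
  path_homotopic p q -> p = q.
Proof. by move=> Hp Hq /reduce_homotopic; rewrite !reduce_id. Qed.

Lemma homotopic_cat u v p q : path_homotopic p q ->
  path_homotopic (u ++ p ++ v) (u ++ q ++ v).
Proof.
elim=> {p q} [p q d|p|p q _ IH|p q r _ IH1 _ IH2].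
- by rewrite -!catA catA (catA u p); apply: (ph_backtrack (u ++ p) (q ++ v)).
- exact: ph_refl.
- exact: ph_sym.
- exact: ph_trans IH1 IH2.
Qed.

Lemma homotopic_catl u p q : path_homotopic p q ->
  path_homotopic (u ++ p) (u ++ q).
Proof. by move=> /(homotopic_cat u [::]); rewrite !cats0. Qed.

Lemma homotopic_catr v p q : path_homotopic p q ->
  path_homotopic (p ++ v) (q ++ v).
Proof. exact: (@homotopic_cat [::] v). Qed.

Lemma path_inv_cat p q : path_inv (p ++ q) = path_inv q ++ path_inv p.
Proof. by rewrite /path_inv map_cat rev_cat. Qed.

Lemma path_inv_rcons p x : path_inv (rcons p x) = inv x :: path_inv p.
Proof. by rewrite /path_inv map_rcons rev_rcons. Qed.

Lemma path_inv_cons p x : path_inv (x :: p) = rcons (path_inv p) (inv x).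
Proof. by rewrite /path_inv /= rev_cons. Qed.

Lemma path_invK p : path_inv (path_inv p) = p.
Proof.
rewrite /path_inv map_rev revK -map_comp.
by under eq_map do rewrite /= invK; rewrite map_id.
Qed.

Lemma homotopic_path_inv p q :
  path_homotopic p q -> path_homotopic (path_inv p) (path_inv q).
Proof.
elim=> {p q} [p q d|p|p q _ IH|p q r _ IH1 _ IH2].
- rewrite !path_inv_cat -catA (_ : path_inv [:: d; inv d] = [:: d; inv d]).
    exact: ph_backtrack.
  by rewrite /path_inv /= invK.
- exact: ph_refl.
- exact: ph_sym.
- exact: ph_trans IH1 IH2.
Qed.

Lemma homotopic_reduce p : path_homotopic p (reduce p).
Proof.
elim: p => [|x p IH]; first exact: ph_refl.
apply: ph_trans (homotopic_catl [:: x] IH) _ => /=.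
case: (reduce p) => [|y s] /=; first exact: ph_refl.
by case: ifP => [/eqP->|_]; [apply: (ph_backtrack [::] s)|apply: ph_refl].
Qed.

Lemma homotopic_cancel p : path_homotopic (path_inv p ++ p) [::].
Proof.
elim: p => [|x p IH]; first exact: ph_refl.
rewrite path_inv_cons cat_rcons; apply: ph_trans IH.
have := ph_backtrack (path_inv p) p (inv x); rewrite invK; exact.
Qed.

Lemma rotr1_rcons p x : rotr 1 (rcons p x) = x :: p.
Proof.
by rewrite -(rot1_cons x p) rotK.
Qed.

Lemma sorted_path_inv p : sorted no_backtrack p -> sorted no_backtrack (path_inv p).
Proof.
rewrite /path_inv rev_sorted sorted_map => Hp.
apply: sub_sorted Hp => x y /=; rewrite !invK.
by rewrite eq_sym.
Qed.

(** Cyclically reduced words that are conjugate are cyclic rotations of each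
   other. If the last dart x of the conjugator r cancels against an end of q, it
   is absorbed into a rotation of q; otherwise r q r^-1 is reduced, hence equal
   to p, which contradicts the cyclic reducedness of p. *)
Lemma conjugate_rot r p q : p != [::] -> q != [::] ->
  cycle no_backtrack p -> cycle no_backtrack q -> sorted no_backtrack r ->
  path_homotopic p (r ++ q ++ path_inv r) -> exists i, p = rot i q.
Proof.
have cs s : cycle no_backtrack s -> sorted no_backtrack s.
  by case: s => //= x s; rewrite rcons_path => /andP[].
move=> p0 q0 cp; elim/last_ind: r q q0 => [|r x IH] q q0 cq sr.
  rewrite /= cats0 => /homotopic_reduced ->; rewrite ?cs //.
  by exists 0; rewrite rot0.
have sr0 : sorted no_backtrack r.
  by move: sr; rewrite -cats1 => /cat_sorted2[].
rewrite path_inv_rcons.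
case: (boolP (head x q == inv x)) => [hq|hq].
  case: q q0 cq hq => //= y q _ cq /eqP Ey H; subst y.
  have q'0 : rcons q (inv x) != [::] by case: (q).
  have cq' : cycle no_backtrack (rcons q (inv x)) by rewrite -rot1_cons rot_cycle.
  have [|i ->] := IH _ q'0 cq' sr0.
    apply: ph_trans H _.
    by rewrite -!cats1 -!catA /=; apply: (ph_backtrack r (_ ++ _)).
  by rewrite -rot1_cons; apply: rot_comp.
case: (boolP (last x q == x)) => [lq|lq].
  case/lastP: q q0 cq hq lq => // q y _ cq _; rewrite last_rcons => /eqP Ey H.
  subst y; have cq' : cycle no_backtrack (x :: q) by rewrite -rotr1_rcons rotr_cycle.
  have [|i ->] := IH (x :: q) isT cq' sr0.
    apply: ph_trans H _; rewrite -!cats1 -!catA /=.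
    by have := ph_backtrack (r ++ x :: q) (path_inv r) x; rewrite -!catA.
  by rewrite -rotr1_rcons; apply: rot_comp.
(* No cancellation is left: the conjugate is a reduced word. *)
set w := _ ++ _ => H.
have sw : sorted no_backtrack w.
  rewrite /w cat_rcons; case: q q0 cq hq lq {H w} => //= y q _ cq hq lq.
  case: r sr {IH sr0} => [|z r] /=.
    move=> _; rewrite hq /= cat_path; rewrite rcons_path in cq.
    case/andP: cq => -> _ /=; rewrite andbT.
    by rewrite (can_eq (@invK G)) eq_sym.
  rewrite rcons_path => /andP[pr /= lr]; rewrite cat_path pr /= lr hq /=.
  rewrite cat_path; rewrite rcons_path in cq; case/andP: cq => -> _ /=.
  rewrite (can_eq (@invK G)) eq_sym lq /=.
  have := @sorted_path_inv (rcons (z :: r) x).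
  by rewrite path_inv_rcons; apply; rewrite /= rcons_path pr.
have Ep := homotopic_reduced (cs _ cp) sw H.
move: cp; rewrite Ep /w.
case: r {IH sr sr0 H w sw Ep} => [|z r] /=.
  rewrite rcons_path last_cat /=.
  by rewrite invK eqxx andbF.
rewrite path_inv_cons.
by rewrite rcons_path !last_cat /= last_rcons invK eqxx andbF.
Qed.

Lemma freely_homotopic_rot p q : p != [::] -> q != [::] ->
  cycle no_backtrack p -> cycle no_backtrack q -> freely_homotopic p q ->
  exists i, p = rot i q.
Proof.
move=> p0 q0 cp cq [u [v [r [_ _ _ H]]]].
apply: (conjugate_rot p0 q0 cp cq (sorted_reduce r)).
apply: ph_trans H _; apply: ph_trans (homotopic_catr _ (homotopic_reduce r)) _.
by apply/homotopic_catl/homotopic_catl/homotopic_path_inv/homotopic_reduce.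
Qed.

Lemma size_push x s : size (push x s) <= (size s).+1.
Proof. by case: s => //= y s; case: ifP => //= _; lia. Qed.

Lemma size_reduce p : size (reduce p) <= size p.
Proof.
by elim: p => //= x p IH; apply: leq_trans (size_push _ _) _; rewrite ltnS.
Qed.

Lemma cyclic_reduction q :
  exists r q0, cycle no_backtrack q0 /\ path_homotopic q (r ++ q0 ++ path_inv r).
Proof.
have [n] := ubnP (size q); elim: n q => // n IH q Hn.
(* Once q is reduced, it can only cancel between its two ends. *)
suff [r [q0 [cq0 H]]] : exists r q0, cycle no_backtrack q0 /\
    path_homotopic (reduce q) (r ++ q0 ++ path_inv r).
  by exists r, q0; split=> //; apply: ph_trans (homotopic_reduce q) H.
have := size_reduce q; have := sorted_reduce q.
case: (reduce q) => [|x s] /= Hs Hsz.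
  by exists [::], [::]; split=> //; apply: ph_refl.
case: (boolP (cycle no_backtrack (x :: s))) => [cs|].
  by exists [::], (x :: s); split=> //; rewrite cats0; apply: ph_refl.
rewrite /= rcons_path Hs /= negbK.
case/lastP: s Hs Hsz => [|s y] Hs Hsz /=.
  by rewrite eq_sym (negbTE (inv_neq _)).
rewrite last_rcons size_rcons in Hsz * => /eqP Ey.
have [|r [q0 [cq0 H]]] := IH s; first by lia.
exists (x :: r), q0; split=> //.
have -> : y = inv x by rewrite Ey invK.
rewrite path_inv_cons -!cats1 /=.
have := homotopic_cat [:: x] [:: inv x] H; by rewrite /= -!catA.
Qed.

Lemma homotopic_power r q n :
  path_homotopic (flatten (nseq n (r ++ q ++ path_inv r)))
    (r ++ flatten (nseq n q) ++ path_inv r).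
Proof.
elim: n => [|n IH] /=.
  apply: ph_sym; rewrite -{1}(path_invK r); exact: homotopic_cancel.
apply: ph_trans (homotopic_catl _ IH) _.
rewrite -!catA; apply/homotopic_catl/homotopic_catl.
rewrite [path_inv r ++ _]catA; exact: (homotopic_catr _ (homotopic_cancel r)).
Qed.

Lemma homotopic_flatten n p q : path_homotopic p q ->
  path_homotopic (flatten (nseq n p)) (flatten (nseq n q)).
Proof.
move=> H; elim: n => [|n IH] /=; first exact: ph_refl.
exact: ph_trans (homotopic_catr _ H) (homotopic_catl _ IH).
Qed.

Lemma cycle_power n q : cycle no_backtrack q -> cycle no_backtrack (flatten (nseq n q)).
Proof.
case: n => // n; case: q => [|x t]; first by elim: n.
move=> /= H; elim: n => [|n IH] /=; first by rewrite cats0.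
by rewrite rcons_cat /= -cat_rcons cat_path H last_rcons.
Qed.

(** A cyclically reduced word that is homotopic to a proper power is invariant
   under a nontrivial cyclic rotation: it is conjugate to a power of the cyclic
   reduction of the root, hence a rotation of this power. *)
Lemma proper_power_rot p : p != [::] -> cycle no_backtrack p -> proper_power p ->
  exists i, [/\ 0 < i, i < size p & rot i p = p].
Proof.
move=> p0 cp [u [q [n [_ _ n1 H]]]].
have [r [q0 [cq0 Hq]]] := cyclic_reduction q.
have {}H := ph_trans H (ph_trans (homotopic_flatten n Hq) (homotopic_power r q0 n)).
have q00 : q0 != [::].
  apply: contra_neqN p0 => /eqP q00; move/reduce_homotopic: H.
  rewrite reduce_id; last by case: (p) cp => //= x s; rewrite rcons_path => /andP[].
  move=> ->; have -> : flatten (nseq n q0) = [::] by rewrite q00; elim: (n).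
  by rewrite -{1}(path_invK r) (reduce_homotopic (homotopic_cancel _)).
have s0 : 0 < size q0 by case: (q0) q00.
have sf m : size (flatten (nseq m q0)) = m * size q0.
  by elim: m => //= m IHm; rewrite size_cat IHm mulSn.
have f0 : flatten (nseq n q0) != [::].
  by rewrite -size_eq0 sf; apply/eqP; nia.
have [i Ep] := conjugate_rot p0 f0 cp (cycle_power n cq0) (sorted_reduce r)
  (ph_trans H (ph_trans (homotopic_catr _ (homotopic_reduce r))
    (homotopic_catl _ (homotopic_catl _
      (homotopic_path_inv (homotopic_reduce r)))))).
(* A power of q0 is invariant under the rotation by the length of q0. *)
exists (size q0); split=> //.
  by rewrite Ep size_rot sf; nia.
rewrite Ep rot_rot; congr rot.
case: n {n1 H f0 Ep} sf => //= n sf.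
rewrite rot_size_cat.
elim: n {sf} => /= [|n IHn]; first by rewrite cats0.
by rewrite -catA IHn.
Qed.

End Words.

(** * Continuing along a path without backtracking *)

Section Next.
Variable G : graph.
Implicit Types d e : dart G.

Lemma src_inv d : src (inv d) = tgt d. Proof. by []. Qed.
Lemma tgt_inv d : tgt (inv d) = src d. Proof. by rewrite /tgt invK. Qed.

(** A continuation of d without backtracking. It is the only one when the target
   of d has valence 2; at an end of valence 1 the value is the junk [inv d]. *)
Definition next d : dart G :=
  odflt (inv d) [pick e | (src e == tgt d) && (e != inv d)].

Lemma exists_other d : 1 < valence (src d) ->
  exists e, src e = src d /\ e != d.
Proof.
rewrite /valence (cardD1 d) inE eqxx ltnS => /card_gt0P[e].
by rewrite !inE => /andP[ne /eqP Ee]; exists e.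
Qed.

Lemma src_next d : src (next d) = tgt d.
Proof. by rewrite /next; case: pickP => // e /andP[/eqP]. Qed.

Lemma next_neq d : 1 < valence (tgt d) -> next d != inv d.
Proof.
case/exists_other=> e [Ee ne]; rewrite /next; case: pickP => [f /andP[]//|].
by move/(_ e); rewrite Ee eqxx ne.
Qed.

Lemma next_uniq d e : valence (tgt d) = 2 ->
  src e = tgt d -> e != inv d -> e = next d.
Proof.
move=> v2 Ee ne; have nn : next d != inv d by rewrite next_neq ?v2.
move/eqP: v2; rewrite /valence (cardD1 (inv d)) inE eqxx eqSS.
move=> /eqP/mem_card1[x Hx].
have He : e \in pred1 x by rewrite -Hx !inE ne Ee eqxx.
have Hn : next d \in pred1 x by rewrite -Hx !inE nn src_next eqxx.
by move: He Hn; rewrite !inE => /eqP-> /eqP->.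
Qed.

Lemma next_inv d : valence (tgt d) = 2 -> next (inv (next d)) = inv d.
Proof.
move=> v2; apply/esym/next_uniq; rewrite ?tgt_inv ?src_next //.
by rewrite invK eq_sym next_neq ?v2.
Qed.

Lemma next_inj d e : valence (tgt d) = 2 -> valence (tgt e) = 2 ->
  next d = next e -> d = e.
Proof.
move=> vd ve E; apply: (can_inj (@invK G)).
by rewrite -(next_inv vd) E next_inv.
Qed.

(** A path through vertices of valence 2 can be traced back. *)
Lemma iter_next_inj n d e :
  (forall k, k < n -> valence (tgt (iter k next d)) = 2) ->
  (forall k, k < n -> valence (tgt (iter k next e)) = 2) ->
  iter n next d = iter n next e -> d = e.
Proof.
elim: n => //= n IH Hd He E; apply: IH => [k kn|k kn|].
- exact/Hd/ltnW.
- exact/He/ltnW.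
- by apply: next_inj E; [apply: Hd|apply: He].
Qed.

Lemma walk_mkseq (a : nat -> dart G) n :
  (forall k, src (a k.+1) = tgt (a k)) ->
  walk (src (a 0)) (mkseq a n) (src (a n)).
Proof.
move=> Ha; suff H i : walk (src (a i)) (map a (iota i n)) (src (a (i + n))).
  exact: H 0.
elim: n i => [|n IH] i /=; first by rewrite addn0.
by rewrite eqxx -Ha addnS -addSn; apply: IH.
Qed.

End Next.

(** Composition of graph maps. *)
Definition comp_map (A B C : graph) (g : graph_map B C) (f : graph_map A B) :=
  GraphMap (gm_vertex := gm_vertex g \o gm_vertex f) (gm_dart := g \o f)
  (fun d => etrans (gm_src g _) (congr1 _ (gm_src f d)))
  (fun d => etrans (congr1 g (gm_inv f d)) (gm_inv g _)).

Lemma tgt_map (A B : graph) (f : graph_map A B) d :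
  tgt (f d) = gm_vertex f (tgt d).
Proof. by rewrite /tgt -gm_inv gm_src. Qed.

Lemma map_next (A B : graph) (f : graph_map A B) d : immersion f ->
  1 < valence (tgt d) -> valence (tgt (f d)) = 2 -> f (next d) = next (f d).
Proof.
move=> If v1 v2; apply: next_uniq => //.
  by rewrite gm_src src_next tgt_map.
rewrite -gm_inv; apply/eqP => E; move/eqP: (next_neq v1); apply.
by apply: If E; rewrite src_next.
Qed.

Lemma map_iter_next (A B : graph) (f : graph_map A B) n d : immersion f ->
  (forall v : vertex A, valence v = 2) ->
  (forall k, k < n -> valence (tgt (iter k (@next B) (f d))) = 2) ->
  f (iter n (@next A) d) = iter n (@next B) (f d).
Proof.
move=> If cA; elim: n => //= n IH H.
have E := IH (fun k kn => H k (ltnW kn)).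
by rewrite map_next ?cA ?E //; apply: H.
Qed.

Section Circles.
Variable G : graph.
Hypothesis cG : forall v : vertex G, valence v = 2.
Implicit Types c d : dart G.

Lemma circle_next_inj : injective (@next G).
Proof. by move=> d e; apply: next_inj; rewrite cG. Qed.

Lemma circle_next_inv d : next (inv (next d)) = inv d.
Proof. by rewrite next_inv ?cG. Qed.

Lemma circle_next_neq d : next d != inv d.
Proof. by rewrite next_neq ?cG. Qed.

Lemma circle_next_uniq d e : src e = tgt d -> e != inv d -> e = next d.
Proof. exact/next_uniq/cG. Qed.

(** On a union of circles, reversing a dart conjugates [next] to its inverse. *)
Lemma iter_next_inv n d : iter n (@next G) (inv (iter n (@next G) d)) = inv d.
Proof.
by elim: n d => //= n IH d; rewrite -iterS iterSr circle_next_inv IH.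
Qed.

Lemma same_component_next d : same_component d (next d).
Proof.
apply: (@connect_trans _ _ (inv d)); apply: connect1 => /=.
  by rewrite eqxx orbT.
by rewrite src_inv src_next eqxx.
Qed.

Lemma same_component_iter n d : same_component d (iter n (@next G) d).
Proof.
elim: n => [|n IH] /=; first exact: connect0.
exact: connect_trans IH (same_component_next _).
Qed.

(** Each component of a union of circles is the union of the two orbits of
   [next] that run around it in opposite directions. *)
Lemma same_componentP c d : same_component c d ->
  fconnect (@next G) c d \/ fconnect (@next G) c (inv d).
Proof.
move=> H; apply/orP.
pose P := [pred d | fconnect (@next G) c d || fconnect (@next G) c (inv d)].
suff cl : fingraph.closed [rel d d' : dart G | (src d == src d') || (d' == inv d)] P.
  by rewrite -[_ || _]/(d \in P) -(closed_connect cl H) inE connect0.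
apply: intro_closed.
  apply: sym_connect_sym => x y /=; rewrite eq_sym; congr (_ || _).
  by apply/eqP/eqP => ->; rewrite invK.
move=> x y /= /orP[/eqP Exy|/eqP->]; last first.
  by rewrite !inE invK orbC.
rewrite !inE; case: (eqVneq y x) => [->//|nyx].
have -> : y = next (inv x) by apply: circle_next_uniq; rewrite ?tgt_inv ?invK.
case/orP=> Hx; last by rewrite (connect_trans Hx) // fconnect1.
apply/orP; right; apply: connect_trans Hx _.
rewrite fconnect_sym; last exact: circle_next_inj.
have := fconnect1 (@next G) (inv (next (inv x))).
by rewrite circle_next_inv invK.
Qed.

End Circles.

(** * Periodic boundary words and conciseness *)

(** A sequence with two periods has their gcd as a period, by Bezout. *)
Lemma gcd_period (T : Type) (a : nat -> T) m n : 0 < m ->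
  (forall k, a (k + m) = a k) -> (forall k, a (k + n) = a k) ->
  forall k, a (k + gcdn m n) = a k.
Proof.
move=> m0 Hm Hn k.
have per p (Hp : forall k, a (k + p) = a k) j i : a (i + j * p) = a i.
  by elim: j i => [|j IH] i; rewrite ?addn0 // mulSn addnA IH Hp.
case: (egcdnP n m0) => km kn E _.
by rewrite -(per n Hn kn) -addnA [gcdn _ _ + _]addnC -E per.
Qed.

Lemma traject_mkseq (T : Type) (f : T -> T) x n :
  traject f x n = mkseq (fun k => iter k f x) n.
Proof.
by elim: n => // n IH; rewrite trajectSr IH -addn1 /mkseq iotaD map_cat cats1.
Qed.

Lemma flatten_mkseq (T : Type) (a : nat -> T) g m :
  (forall k, a (k + g) = a k) ->
  flatten (nseq m (mkseq a g)) = mkseq a (m * g).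
Proof.
move=> Hg; elim: m => //= m ->; rewrite mulSn /mkseq iotaD map_cat add0n.
congr (_ ++ _); rewrite -{2}[g]addn0 iotaDl -map_comp.
by apply: eq_map => k /=; rewrite addnC.
Qed.

Section Attaching.
Variables (C S : graph) (f : graph_map C S).
Hypothesis cC : forall v : vertex C, valence v = 2.
Hypothesis If : immersion f.
Implicit Types c : dart C.
Local Notation nx := (@next C).

Lemma order_gt0 c : 0 < order nx c.
Proof. by rewrite /order (cardD1 c) [c \in _]connect0. Qed.

Lemma iter_mod_order k c : iter (k %% order nx c) nx c = iter k nx c.
Proof.
rewrite {2}(divn_eq k (order nx c)) addnC iterD.
have -> : iter (k %/ order nx c * order nx c) nx c = c => //.
elim: (k %/ _) => [|m IH] //; rewrite mulSn iterD IH iter_order //.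
exact: circle_next_inj.
Qed.

Lemma iter_mod_mult k m c : order nx c %| m -> iter (k %% m) nx c = iter k nx c.
Proof. by move=> d; rewrite -[RHS]iter_mod_order -(modn_dvdm k d) iter_mod_order. Qed.

(** The word read along the circle of c has the length of this circle as a
   period. Any period that is not a multiple of this length makes it a proper
   power. *)
Lemma proper_power_of_period c q :
  (forall k, f (iter (k + q) nx c) = f (iter k nx c)) ->
  ~~ (order nx c %| q) -> proper_power (map f (orbit nx c)).
Proof.
move=> Hq nd; pose n := order nx c; pose a k := f (iter k nx c).
have Hn k : a (k + n) = a k by rewrite /a -(iter_mod_order (k + n)) modnDr iter_mod_order.
have Hg := gcd_period (order_gt0 c) Hn Hq; pose g := gcdn n q.
have gn : g %| n by apply: dvdn_gcdl.
have Ea k : src (a k.+1) = tgt (a k).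
  by rewrite /a /= gm_src src_next tgt_map.
have E : map f (orbit nx c) = mkseq a n.
  by rewrite /orbit traject_mkseq /mkseq -map_comp.
exists (src (a 0)), (mkseq a g), (n %/ g); split.
- have := walk_mkseq n Ea; rewrite E.
  by have -> : a n = a 0 by rewrite -[n]add0n Hn.
- have := walk_mkseq g Ea.
  by have -> : a g = a 0 by rewrite -[g]add0n Hg.
- have g0 : 0 < g by rewrite gcdn_gt0 order_gt0.
  rewrite ltn_divRL // mul1n ltn_neqAle dvdn_leq ?order_gt0 // andbT.
  by apply: contra nd => /eqP gE; rewrite -/n -gE dvdn_gcdr.
- by rewrite flatten_mkseq // divnK // E; apply: ph_refl.
Qed.

(** The words read from c and from a dart running along the same circle in the
   opposite direction differ. Otherwise the reflection of the circle that they
   define fixes a vertex or reverses an edge: the first contradicts the local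
   injectivity of f, the second the absence of darts equal to their inverses. *)
Lemma no_reverse c c' : inv c' \in orbit nx c ->
  ~ (forall k, f (iter k nx c) = f (iter k nx c')).
Proof.
rewrite -fconnect_orbit => /iter_findex.
move: (findex _ _ _) => j Ej H.
have R k l : k + l = j -> f (iter k nx c) = inv (f (iter l nx c)).
  move=> kl; rewrite H -gm_inv -(invK c') -Ej -kl iterD.
  by rewrite (iter_next_inv cC).
(* The reflection exchanges k and j - k. It fixes j / 2 when j is even, and
   exchanges j / 2 with its successor when j is odd. *)
have [Oj|Ej2] := boolP (odd j); last first.
  have := R j./2 j./2; rewrite addnn even_halfK // => /(_ erefl)/esym/eqP.
  by rewrite (negbTE (inv_neq _)).
have := R j./2.+1 j./2; rewrite addSn addnn odd_halfK //.
rewrite prednK; last by case: (j) Oj.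
move=> /(_ erefl); rewrite -gm_inv; set x := iter j./2 nx c.
move/If => /=; rewrite src_next => /(_ erefl)/eqP.
by rewrite (negbTE (circle_next_neq cC _)).
Qed.

(** Two darts of the same circle from which the same infinite word is read
   differ by a translation, so that the word is a proper power. *)
Lemma injective_unless_power c c' : same_component c c' -> c != c' ->
  (forall k, f (iter k nx c) = f (iter k nx c')) ->
  proper_power (map f (orbit nx c)).
Proof.
move=> cc' ne H; case: (same_componentP cC cc').
  move=> /iter_findex Ej; apply: (@proper_power_of_period _ (findex nx c c')).
    by move=> k; rewrite iterD Ej.
  by apply: contra ne => d; rewrite -Ej -(iter_mod_order (findex _ _ _)) (eqP d).
by rewrite fconnect_orbit => /no_reverse.
Qed.

End Attaching.

Lemma orbit_boundary_cycle (X : complex) c :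
  boundary_cycle (face_of c) (orbit (@next (bdry X)) c).
Proof.
have cX := @bdry_circles X; have ni := circle_next_inj cX.
split.
- by rewrite -size_eq0 size_orbit -lt0n order_gt0.
- rewrite /ucycle orbit_uniq andbT.
  apply: sub_cycle (cycle_orbit ni c) => x y /= /eqP <-.
  by rewrite src_next eqxx circle_next_neq.
- move=> b; rewrite -fconnect_orbit => /iter_findex <-.
  by apply/esym/face_of_component/same_component_iter.
Qed.

(** The form in which conciseness is used: the infinite periodic words read
   along the attaching circles from two different darts are different. *)
Lemma concise_separates (X : complex) (c c' : dart (bdry X)) :
  concise X -> c != c' ->
  ~ (forall k, att X (iter k (@next (bdry X)) c) =
               att X (iter k (@next (bdry X)) c')).
Proof.
move=> cX ne H; apply: cX.
have cB := @bdry_circles X; have aI := @att_immersion X.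
have pp d (Hd : proper_power (map (att X) (orbit (@next (bdry X)) d))) :
    exists f s, boundary_cycle f s /\ proper_power (map (att X) s).
  exists (face_of d), (orbit (@next (bdry X)) d); split=> //.
  exact: orbit_boundary_cycle.
have per d d' (Hd : forall k, att X (iter k (@next (bdry X)) d) =
    att X (iter k (@next (bdry X)) d')) : forall k,
    att X (iter (k + order (@next (bdry X)) d') (@next (bdry X)) d) =
    att X (iter k (@next (bdry X)) d).
  by move=> k; rewrite Hd -(iter_mod_order cB (_ + _)) modnDr (iter_mod_order cB) Hd.
case: (boolP (order (@next (bdry X)) c %| order (@next (bdry X)) c')); last first.
  by move/(proper_power_of_period cB (per _ _ H))/pp; right.
have H' := fun k => esym (H k).
case: (boolP (order (@next (bdry X)) c' %| order (@next (bdry X)) c)); last first.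
  by move/(proper_power_of_period cB (per _ _ H'))/pp; right.
move=> d1 d2; have E : order (@next (bdry X)) c = order (@next (bdry X)) c'.
  by apply/eqP; rewrite eqn_dvd d1 d2.
case: (eqVneq (face_of c) (face_of c')) => [/face_of_component sc|/eqP nf].
  by right; apply/pp/(injective_unless_power cB aI sc ne H).
left; exists (face_of c), (face_of c'); do 2 eexists; split=> //.
- exact: orbit_boundary_cycle.
- exact: orbit_boundary_cycle.
rewrite /orbit E !traject_mkseq /mkseq -!map_comp.
have -> : map (att X \o (fun k => iter k (@next (bdry X)) c)) =1
          map (att X \o (fun k => iter k (@next (bdry X)) c')).
  by apply: eq_map.
have W d : walk (src (att X d)) (map (att X) (orbit (@next (bdry X)) d)) (src (att X d)).
  have Ea k : src (att X (iter k.+1 (@next (bdry X)) d)) =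
    tgt (att X (iter k (@next (bdry X)) d)).
    by rewrite /= gm_src src_next tgt_map.
  have := walk_mkseq (order (@next (bdry X)) d) Ea.
  rewrite iter_order; last exact: circle_next_inj.
  by rewrite /orbit traject_mkseq /mkseq -map_comp.
have := W c'; rewrite /orbit traject_mkseq /mkseq -map_comp => Wc.
exists (src (att X c')), (src (att X c')), [::]; split=> //=.
by rewrite cats0; apply: ph_refl.
Qed.

(** * Homotopy equivalences of graphs, Euler characteristic and cycles modulo 2 *)

Section Orientation.
Variable G : graph.
Implicit Types d : dart G.

(** An orientation: exactly one of the two darts of each edge is positive. *)
Definition positive d := enum_rank d < enum_rank (inv d).

Lemma positive_inv d : positive (inv d) = ~~ positive d.
Proof.
rewrite /positive invK ltn_neqAle.
suff -> : nat_of_ord (enum_rank (inv d)) != enum_rank d by rewrite leqNgt.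
by rewrite (inj_eq val_inj) (inj_eq enum_rank_inj) inv_neq.
Qed.

Lemma card_darts : #|dart G| = 2 * #|edges G|.
Proof.
rewrite -[#|dart G|]sum1_card (bigID positive) /=.
rewrite [X in _ + X](reindex_inj (can_inj (@invK G))) /=.
under [X in _ + X]eq_bigl do rewrite positive_inv negbK.
rewrite addnn -mul2n; congr (2 * _).
have -> : edges G = [set [set d; inv d] | d in [pred d | positive d]].
  apply/setP=> e; apply/imsetP/imsetP => -[d _ ->]; last by exists d.
  case: (boolP (positive d)) => Hd; first by exists d.
  exists (inv d); rewrite ?inE ?positive_inv //.
  by rewrite invK finset.setUC.
rewrite card_in_imset ?sum1_card // => d d'; rewrite !inE => Hd Hd' E.
have : d \in [set d'; inv d'] by rewrite -E !inE eqxx.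
rewrite !inE => /orP[/eqP//|/eqP Ed].
by rewrite Ed positive_inv Hd' in Hd.
Qed.

End Orientation.

Section Flow.
Variable A : graph.
Implicit Types (p q : seq (dart A)) (d : dart A) (v : vertex A).
Local Open Scope ring_scope.

(** The algebraic number of passages of p through d: the coefficient of d in the
   1-chain of p. *)
Definition flow p d : int := (count_mem d p)%:Z - (count_mem (inv d) p)%:Z.

Lemma flow_cat p q d : flow (p ++ q) d = flow p d + flow q d.
Proof. by rewrite /flow !count_cat; lia. Qed.

Lemma flow_inv p d : flow p (inv d) = - flow p d.
Proof. by rewrite /flow invK; lia. Qed.

Lemma eq_inv_sym (d e : dart A) : (inv d == e) = (d == inv e).
Proof. by apply/eqP/eqP => [<-|->]; rewrite invK. Qed.

Lemma flow_homotopic p q d : path_homotopic p q -> flow p d = flow q d.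
Proof.
elim=> {p q} [p q e|//|//|p q r _ -> _ ->//].
rewrite !flow_cat -(cat1s e) flow_cat [flow [:: e] _]/flow [flow [:: inv e] _]/flow /=.
by rewrite !eq_inv_sym invK; lia.
Qed.

(** The boundary of the 1-chain of a walk. *)
Lemma flow_source u p w v : walk u p w ->
  \sum_(d | src d == v) flow p d = (u == v)%:R - (w == v)%:R.
Proof.
elim: p u => [|x p IH] u /=.
  by move/eqP->; rewrite subrr big1.
case/andP=> /eqP <- /IH IHp; rewrite -cat1s.
under eq_bigr do rewrite flow_cat.
rewrite big_split /= IHp.
have -> : \sum_(d | src d == v) flow [:: x] d = (src x == v)%:R - (tgt x == v)%:R.
  rewrite /flow /= sumrB; congr (_ - _).
    under eq_bigr do rewrite addn0.
    rewrite (big_mkcond) (bigD1 x) //= eqxx big1 ?addr0; first by case: eqP.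
    by move=> d nd; rewrite [x == d]eq_sym (negbTE nd); case: ifP.
  under eq_bigr do rewrite addn0.
  rewrite (big_mkcond) (bigD1 (inv x)) //= invK eqxx big1 ?addr0.
    by rewrite src_inv; case: eqP.
  by move=> d nd; rewrite -eq_inv_sym [inv x == d]eq_sym (negbTE nd); case: ifP.
by rewrite addrA subrK.
Qed.

(** The Hopf trace formula for a self-map homotopic to the identity: the number
   of fixed vertices minus the trace on 1-chains is the Euler characteristic. All
   quantities are doubled, since darts are counted instead of edges. *)
Lemma trace_formula (fv : vertex A -> vertex A) (fd : dart A -> seq (dart A)) :
  maps_homotopic fv id fd (fun d => [:: d]) ->
  \sum_d flow (fd d) d =
  #|dart A|%:Z + 2 * (#|[set v | fv v == v]|%:Z - #|vertex A|%:Z).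
Proof.
case=> h [hw hh].
have E d : flow (fd d) d = 1 + flow (h (src d)) d - flow (h (tgt d)) d.
  have := flow_homotopic d (hh d); rewrite !flow_cat.
  rewrite [flow [:: d] d]/flow /= eqxx eq_sym (negbTE (inv_neq d)); lia.
under eq_bigr do rewrite E.
rewrite sumrB big_split /= sumr_const.
have -> : \sum_d flow (h (tgt d)) d = - \sum_d flow (h (src d)) d.
  rewrite (reindex_inj (can_inj (@invK A))) /= -sumrN.
  by apply: eq_bigr => d _; rewrite tgt_inv flow_inv.
have -> : \sum_d flow (h (src d)) d = #|[set v | fv v == v]|%:Z - #|vertex A|%:Z.
  rewrite (partition_big (@src A) predT) //=.
  under eq_bigr => v _.
    rewrite (eq_bigr (flow (h v))); last by move=> d /eqP ->.
    rewrite (flow_source v (hw v)) eqxx; over.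
  rewrite sumrB sumr_const; congr (_ - _).
    rewrite -sum1_card -natz natr_sum [RHS]big_mkcond /=.
    by apply: eq_bigr => v _; rewrite inE; case: eqP.
  by rewrite natz; congr Posz; apply: eq_card.
rewrite opprK -addrA -mulr2n; congr (_ + _).
by rewrite natz; congr Posz; apply: eq_card.
by rewrite mulr_natl.
Qed.

End Flow.

Lemma flow_map (A B : graph) (f : graph_map A B) p (e : dart B) :
  flow (map f p) e = (\sum_(d | f d == e) flow p d)%R.
Proof.
elim: p => [|x p IH]; first by rewrite big1.
rewrite -cat1s map_cat flow_cat IH; under [in RHS]eq_bigr do rewrite flow_cat.
rewrite [RHS]big_split /=; congr (_ + _)%R.
rewrite /flow /= sumrB; congr (_ - _)%R.
  rewrite (big_mkcond) (bigD1 x) //= eqxx big1 ?addr0; first by case: eqP.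
  by move=> d nd; rewrite [x == d]eq_sym (negbTE nd); case: ifP.
rewrite (big_mkcond) (bigD1 (inv x)) //= invK eqxx big1 ?addr0.
  by rewrite gm_inv eq_inv_sym; case: eqP.
by move=> d nd; rewrite -eq_inv_sym [inv x == d]eq_sym (negbTE nd); case: ifP.
Qed.

(** Homotopy equivalent graphs have the same Euler characteristic. If g is a
   homotopy inverse of f, then g f and f g have the same traces on 0-chains and
   on 1-chains, so that their trace formulas give the same result. *)
Lemma homotopy_equivalence_euler (A B : graph) (f : graph_map A B) :
  homotopy_equivalence f ->
  #|dart A| + 2 * #|vertex B| = #|dart B| + 2 * #|vertex A|.
Proof.
case=> gv [gd [_ _ /trace_formula HA /trace_formula HB]].
have E : (\sum_e flow [seq f x | x <- gd e] e = \sum_d flow (gd (f d)) d)%R.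
  under eq_bigr do rewrite flow_map.
  rewrite (exchange_big_dep predT) //=; apply: eq_bigr => d _.
  by rewrite (big_pred1 (f d)) //= => e; rewrite eq_sym.
have F : #|[set v | gv (gm_vertex f v) == v]| = #|[set v | gm_vertex f (gv v) == v]|.
  rewrite -(@card_in_imset _ _ (gm_vertex f) [set v | gv (gm_vertex f v) == v]).
    congr #|pred_of_set _|; apply/setP=> v; apply/imsetP/idP.
      by case=> u; rewrite !inE => /eqP E1 ->; rewrite E1.
    by rewrite inE => /eqP Ev; exists (gv v); rewrite ?inE Ev.
  by move=> u v; rewrite !inE => /eqP Eu /eqP Ev E1; rewrite -Eu E1.
by move: HA HB; rewrite E F => ->; lia.
Qed.

Section Parity.
Local Notation "\bigxor_ ( i <- r ) F" := (\big[addb/false]_(i <- r) F)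
  (at level 41, i, r at level 50).
Local Notation "\bigxor_ i F" := (\big[addb/false]_i F) (at level 41, i at level 0).

Lemma xor_count (T : finType) (s : seq T) (K : T -> bool) :
  \bigxor_(x <- s) K x = \bigxor_x (odd (count_mem x s) && K x).
Proof.
elim: s => [|y s IH]; first by rewrite big_nil big1.
rewrite big_cons IH (bigD1 y) //= [in RHS](bigD1 y) //= eqxx oddD.
rewrite andb_addl addbA; congr (_ (+) _).
by apply: eq_bigr => x nx; rewrite eq_sym (negbTE nx).
Qed.

(** An invariant function sums to 0 modulo 2 over the darts, which the
   inversion groups into pairs. *)
Lemma xor_involution (G : graph) (F : dart G -> bool) :
  (forall d, F (inv d) = F d) -> \bigxor_d F d = false.
Proof.
move=> HF; rewrite (bigID (@positive G)) /=.
rewrite [X in _ (+) X](reindex_inj (can_inj (@invK G))) /=.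
under [X in _ (+) X]eq_bigl do rewrite positive_inv negbK.
by under [X in _ (+) X]eq_bigr do rewrite HF; rewrite addbb.
Qed.

Section Graph.
Variable G : graph.
Implicit Types (p q : seq (dart G)) (d : dart G).

(** The coefficient of the edge of d in the 1-chain of p modulo 2. *)
Definition parity p d : bool := odd (count_mem d p + count_mem (inv d) p).

Lemma parity_cat p q d : parity (p ++ q) d = parity p d (+) parity q d.
Proof. by rewrite /parity !count_cat -oddD; congr odd; lia. Qed.

Lemma parity_homotopic p q d : path_homotopic p q -> parity p d = parity q d.
Proof.
elim=> {p q} [p q e|//|//|p q r _ -> _ ->//].
rewrite !parity_cat -(cat1s e) parity_cat.
rewrite [parity [:: e] _]/parity [parity [:: inv e] _]/parity /=.
by rewrite !eq_inv_sym invK !addn0 [X in _ (+) odd X]addnC addbb.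
Qed.

Lemma parity_path_inv p d : parity (path_inv p) d = parity p d.
Proof.
rewrite /parity /path_inv !count_rev !count_map addnC; congr (odd (_ + _)).
  by apply: eq_count => e /=; rewrite eq_inv_sym invK.
by apply: eq_count => e /=; rewrite eq_inv_sym.
Qed.

Lemma parity_flatten (T : Type) (F : T -> seq (dart G)) s d :
  parity (flatten (map F s)) d = \bigxor_(x <- s) parity (F x) d.
Proof.
by elim: s => [|x s IH]; rewrite ?big_nil // big_cons /= parity_cat IH.
Qed.

(** When b maps a graph C, the sum of the edges of C (each taken
   once, in its positive orientation) is pushed to the chain whose coefficient
   at d is the number of darts of C over d. *)
Lemma parity_positive (C : graph) (b : graph_map C G) d :
  parity [seq b x | x <- enum (dart C) & positive x] d =
  odd #|[set x | b x == d]|.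
Proof.
have E P : count P [seq b x | x <- enum (dart C) & positive x] =
    \sum_(x | positive x && P (b x)) 1.
  rewrite count_map count_filter -sum1_count big_enum_cond /=.
  by apply: eq_bigl => x; rewrite andbC.
rewrite /parity !E -sum1_card; congr odd; rewrite [RHS](bigID (@positive C)) /=.
congr (_ + _); first by apply: eq_bigl => x; rewrite inE andbC.
rewrite [RHS](reindex_inj (can_inj (@invK C))) /=; apply: eq_bigl => x.
by rewrite inE positive_inv negbK gm_inv eq_inv_sym andbC.
Qed.

(** The sum of the edges of a union of circles is pushed to a cycle modulo 2:
   each vertex of C lying over v contributes its two darts. *)
Lemma circle_cycle (C : graph) (b : graph_map C G) v :
  (forall c : vertex C, valence c = 2) ->
  ~~ odd (\sum_(x <- [seq b x | x <- enum (dart C) & positive x])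
           ((src x == v) + (tgt x == v))).
Proof.
move=> cC; rewrite big_map big_filter big_enum_cond /= big_split /=.
have -> : \sum_(x | positive x) (tgt (b x) == v) =
          \sum_(x | ~~ positive x) (src (b x) == v).
  rewrite (reindex_inj (can_inj (@invK C))) /=.
  by apply: eq_big => x; rewrite ?positive_inv // gm_inv tgt_inv.
rewrite -(bigID (@positive C) predT (fun x => nat_of_bool (src (b x) == v))) /=.
rewrite (partition_big (@src C) predT) //=.
rewrite (eq_bigr (fun c => 2 * (gm_vertex b c == v))) => [|c _].
  by rewrite -big_distrr /= oddM.
rewrite (eq_bigr (fun=> nat_of_bool (gm_vertex b c == v))) => [|x /eqP <-].
  by rewrite sum_nat_const -(cC c) /valence cardsE.
by rewrite gm_src.
Qed.

Lemma xor_odd (T : Type) (s : seq T) (n : T -> nat) k :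
  \bigxor_(x <- s) (odd (n x) && k) = odd (\sum_(x <- s) n x) && k.
Proof.
by elim: s => [|x s IH]; rewrite ?big_nil // !big_cons IH oddD andb_addl.
Qed.

(** A self-map homotopic to the identity fixes the cycles modulo 2: the chain
   homotopy formula, in which the homotopy contributes only at the boundary. *)
Lemma parity_homotopic_id (fv : vertex G -> vertex G)
    (fd : dart G -> seq (dart G)) s e :
  maps_homotopic fv id fd (fun d => [:: d]) ->
  (forall v, ~~ odd (\sum_(x <- s) ((src x == v) + (tgt x == v)))) ->
  parity (flatten (map fd s)) e = parity s e.
Proof.
case=> h [_ hh] Hs; pose K v := parity (h v) e.
(* The chain homotopy formula on the edge of d. *)
have E d : parity (fd d) e = parity [:: d] e (+) (K (src d) (+) K (tgt d)).
  have := parity_homotopic e (hh d); rewrite !parity_cat -/(K (src d)) -/(K (tgt d)).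
  case: (parity (fd d) e); case: (K (src d)); case: (K (tgt d));
    by case: (parity [:: d] e).
rewrite parity_flatten; under eq_bigr do rewrite E.
rewrite big_split /= -(parity_flatten (fun d => [:: d])) flatten_map1 map_id.
rewrite [X in _ (+) X](_ : _ = false) ?addbF //.
have KE u : K u = \bigxor_v (odd (u == v) && K v).
  by rewrite (bigD1 u) //= eqxx big1 ?addbF // => v nv; rewrite eq_sym (negbTE nv).
have KE2 x : K (src x) (+) K (tgt x) =
    \bigxor_v (odd ((src x == v) + (tgt x == v)) && K v).
  rewrite {1}(KE (src x)) {1}(KE (tgt x)) -big_split /=.
  by apply: eq_bigr => v _; rewrite oddD andb_addl.
under eq_bigr do rewrite KE2.
rewrite exchange_big big1 //= => v _.
by rewrite xor_odd (negbTE (Hs v)).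
Qed.

End Graph.

(** The image of a word only depends, modulo 2, on its chain: a null chain is
   pushed to a null chain. *)
Lemma parity_null (A B : graph) (gd : dart A -> seq (dart B)) s e :
  (forall d, gd (inv d) = path_inv (gd d)) ->
  (forall x, parity s x = false) ->
  parity (flatten (map gd s)) e = false.
Proof.
move=> Hg Hs; rewrite parity_flatten xor_count; apply: xor_involution => d.
rewrite Hg parity_path_inv; congr (_ && _).
by move: (Hs d); rewrite /parity oddD; do 2!case: (odd _).
Qed.

(** A homotopy equivalence f is injective on cycles modulo 2. Applied to the cycle
   defined by a union of circles C, this says that if an even number of sides
   lies over each edge of B, then an even number lies over each edge of A. *)
Lemma even_lift (A B C : graph) (f : graph_map A B) (b : graph_map C A) :
  homotopy_equivalence f -> (forall c : vertex C, valence c = 2) ->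
  (forall e, ~~ odd #|[set x | f (b x) == e]|) ->
  forall d, ~~ odd #|[set x | b x == d]|.
Proof.
case=> gv [gd [_ Hg HA _]] cC He d.
rewrite -(parity_positive b).
rewrite -(parity_homotopic_id _ HA (fun v => circle_cycle b v cC)).
set s := [seq b x | x <- _ & _].
rewrite (_ : map (fun d => gd (f d)) s = map gd (map f s)); last by rewrite -map_comp.
rewrite parity_null // => x; rewrite /s -map_comp.
by have := parity_positive (comp_map f b) x => /= ->; apply/negbTE/He.
Qed.
End Parity.

Lemma walk_closed (G : graph) (W : pred (vertex G)) u p v :
  (forall d : dart G, W (src d) = W (tgt d)) -> walk u p v -> W u = W v.
Proof.
move=> HW; elim: p u => [|d p IH] u /=; first by move/eqP->.
by case/andP=> /eqP <- /IH <-.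
Qed.

(** A homotopy equivalence is injective on components: a union of components
   contains both or neither of two vertices with the same image. *)
Lemma homotopy_equivalence_component (A B : graph) (f : graph_map A B)
    (W : pred (vertex A)) u v :
  homotopy_equivalence f -> (forall d : dart A, W (src d) = W (tgt d)) ->
  gm_vertex f u = gm_vertex f v -> W u = W v.
Proof.
case=> gv [gd [_ _ [h [hw _]] _]] HW E.
by rewrite -(walk_closed HW (hw u)) -(walk_closed HW (hw v)) E.
Qed.

(** * The curvature gap over a concise complex *)

(** An immersion of circles is a covering, hence surjective. *)
Lemma immersion_onto_component (A B : graph) (f : graph_map A B) a b :
  (forall v : vertex A, valence v = 2) -> (forall v : vertex B, valence v = 2) ->
  immersion f -> same_component (f a) b -> exists a', f a' = b.
Proof.
move=> cA cB If /(same_componentP cB)[] /iter_findex; move: (findex _ _ _) => k.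
  by rewrite -map_iter_next //; exists (iter k (@next A) a).
rewrite -map_iter_next // => E; exists (inv (iter k (@next A) a)).
by rewrite gm_inv E invK.
Qed.

Lemma card_bdry (X : complex) : #|dart (bdry X)| = \sum_(f : face X) perimeter f.
Proof.
rewrite -sum1_card (partition_big (@face_of X) predT) //=.
by apply: eq_bigr => f _; rewrite /perimeter -sum1_card; apply: eq_bigl => b; rewrite inE.
Qed.

Lemma perimeter_gt0 (X : complex) (f : face X) : 0 < perimeter f.
Proof.
by have [b <-] := face_of_surj f; apply/card_gt0P; exists b; rewrite inE.
Qed.

(** A map which is bijective on faces, with multiplicities 1, is bijective on the
   attaching circles: it is surjective, and the perimeters agree. *)
Lemma bdry_bijective (Y Z : complex) (phi : morphism Y Z) :
  bijective (mor_face phi) -> (forall f, mor_mult phi f = 1) ->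
  bijective (mor_bdry phi).
Proof.
move=> bf m1; have [g gK Kg] := bf.
have sur c : exists b, mor_bdry phi b = c.
  have [b Eb] := face_of_surj (g (face_of c)).
  apply: (immersion_onto_component (a := b)).
  - exact: bdry_circles.
  - exact: bdry_circles.
  - exact: mor_bdry_immersion.
  - by apply/face_of_component; rewrite mor_face_of Eb Kg.
have E : #|dart (bdry Y)| = #|dart (bdry Z)|.
  rewrite !card_bdry (reindex (mor_face phi)) /=; last exact: onW_bij.
  by apply: eq_bigr => f _; rewrite (mor_perimeter phi) m1 mul1n.
apply: inj_card_bij; last by rewrite E.
have : {in dart (bdry Y) &, injective (mor_bdry phi)}.
  apply/image_injP; rewrite E; apply/eqP/eq_card => c.
  by have [b <-] := sur c; rewrite [RHS]inE fintype.image_f.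
by move=> H x y; apply: H.
Qed.

Lemma essential_folding_bdry (Y X Z : complex) (phi : morphism Y X)
    (phi0 : morphism Y Z) (phi1 : morphism Z X) :
  essential_folding phi phi0 phi1 -> bijective (mor_bdry phi0).
Proof. by case=> _ _ bf m1; apply: bdry_bijective. Qed.

Lemma essential_equivalence_bdry (Y X : complex) (phi : morphism Y X) :
  essential_equivalence phi -> bijective (mor_bdry phi).
Proof.
case=> Z [phi0 [phi1 [ef [_ _ _ b1 _]]]].
have b0 := essential_folding_bdry ef; have [[_ [_ E] _ _] _ _ _] := ef.
exact: eq_bij (bij_comp b1 b0) _ (fun x => esym (E x)).
Qed.

Lemma essential_equivalence_euler (Y X : complex) (phi : morphism Y X) :
  essential_equivalence phi ->
  #|dart (skel Y)| + 2 * #|vertex (skel X)| =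
  #|dart (skel X)| + 2 * #|vertex (skel Y)|.
Proof.
case=> Z [phi0 [phi1 [[_ /homotopy_equivalence_euler E _ _] [bv bd _ _ _]]]].
by rewrite -(bij_eq_card bv) -(bij_eq_card bd).
Qed.

(** An essential map is determined on each side of a face by the underlying edge
   of Y and the side of a face of X. This is where both the immersion of the
   folded complex and the bijectivity on faces are used. *)
Lemma essential_injective (Y X : complex) (phi : morphism Y X) :
  essential phi -> injective (fun b => (att Y b, mor_bdry phi b)).
Proof.
case=> Z [phi0 [phi1 ef]] b b' [E1 E2]; have [[_ [_ E] iZ _] _ _ _] := ef.
apply: (bij_inj (essential_folding_bdry ef)); apply: iZ => /=.
by rewrite -!mor_att E1 -!E E2.
Qed.

Lemma sum_valence (G : graph) (P : pred (vertex G)) :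
  \sum_(v | P v) valence v = #|[set d : dart G | P (src d)]|.
Proof.
rewrite -sum1_card (partition_big (@src G) P) => [|d]; last by rewrite inE.
apply: eq_bigr => v Pv; rewrite /valence -sum1_card; apply: eq_bigl => d.
by rewrite !inE andbC; case: eqP => // ->.
Qed.

Lemma card_darts_valence (G : graph) : #|dart G| = \sum_(v : vertex G) valence v.
Proof. by rewrite sum_valence; apply: eq_card => d; rewrite !inE. Qed.

Lemma valence_gt1 (X : complex) (v : vertex (skel X)) :
  ~ low_valence X -> 1 < valence v.
Proof. by move=> nl; rewrite ltnNge; apply/negP => ?; apply: nl; exists v. Qed.

Lemma leq_vertices_darts (X : complex) : ~ low_valence X ->
  2 * #|vertex (skel X)| <= #|dart (skel X)|.
Proof.
move=> nl; rewrite card_darts_valence mulnC -sum_nat_const.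
by apply: leq_sum => v _; apply: valence_gt1.
Qed.

(** The right-hand side is -6 times the Euler characteristic; vertices of
   valence 2 contribute to neither side. *)
Lemma branch_bound (X : complex) : ~ low_valence X ->
  #|[set d : dart (skel X) | 2 < valence (src d)]| <=
  3 * (#|dart (skel X)| - 2 * #|vertex (skel X)|).
Proof.
move=> nl; rewrite mulnBr leq_subRL; last by rewrite leq_mul2l leq_vertices_darts ?orbT.
rewrite -(@sum_valence (skel X) (fun v => 2 < valence v)) card_darts_valence.
rewrite mulnA mulnC -sum_nat_const [X in _ + X <= _]big_mkcond -big_split big_distrr /=.
apply: leq_sum => v _; have := valence_gt1 v nl.
by case: ifP; lia.
Qed.

(** In a complex that is not visibly reducible, each edge has at least two sides:
   it is not free, and an edge without sides would be isolated in the link of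
   its origin. *)
Lemma two_sides (X : complex) (d : dart (skel X)) : ~ visibly_reducible X ->
  exists b b', [/\ b != b', att X b = d & att X b' = d].
Proof.
move=> nr; have nl : ~ low_valence X by move=> l; apply: nr; constructor 1.
have : #|[set b | att X b == d]| != 1.
  by apply/eqP => H; apply: nr; constructor 3; exists d.
have : 0 < #|[set b | att X b == d]|.
  have [e [Ee ne]] := exists_other (valence_gt1 (src d) nl).
  have : connect (@link_adj X) d e.
    apply: contra_notT nr => nc; constructor 2; exists (src d), d, e.
    by split.
  case/connectP => -[|x p] /=; first by move=> _ E; rewrite E eqxx in ne.
  case/andP=> /existsP[b /existsP[b' /and4P[_ _ Eb _]]] _ _.
  by apply/card_gt0P; exists b; rewrite inE.
move=> H0 H1; have : 1 < #|[set b | att X b == d]| by case: #|_| H0 H1 => [|[]].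
case/card_gt1P => b [b' []]; rewrite !inE => /eqP Eb /eqP Eb' ne.
by exists b, b'.
Qed.

Section Segments.
Variables (X W : complex) (F : graph_map (skel W) (skel X))
  (beta : graph_map (bdry W) (bdry X)).
Hypotheses (cX : concise X) (rW : ~ visibly_reducible W).
Hypotheses (Ib : immersion beta) (FE : forall b, F (att W b) = att X (beta b)).
Hypothesis inj : injective (fun b => (att W b, beta b)).
Local Notation nx := (@next _).
Local Notation N := #|dart (bdry X)|.

(** Segments of W, i.e. paths through vertices of valence 2, have bounded length.
   Two sides of faces on the first edge of a long segment run together along the
   whole segment; in X, they read the same periodic words for longer than a
   common multiple of the two periods, hence for ever. As X is concise, they are
   the same side of a face of X, hence of W. *)
Lemma short_segments (d : dart (skel W)) :
  exists k, (k < N * N) && (valence (tgt (iter k nx d)) != 2).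
Proof.
have cB := @bdry_circles; have [b [b' [nb Eb Eb']]] := two_sides d rW.
apply: contrapT => /forallNP H.
have v2 k : k < N * N -> valence (tgt (iter k nx d)) = 2.
  by move=> kN; apply/eqP; have /negP := H k; rewrite kN negbK.
have Hk c k : att W c = d -> k < N * N ->
    att X (iter k nx (beta c)) = F (iter k nx d).
  move=> Ec kN; rewrite -map_iter_next //.
  (* Both the side c and the skeleton of W continue uniquely along the segment. *)
  rewrite -FE map_iter_next ?Ec //; first exact: att_immersion.
  by move=> j jk; apply/v2/(ltn_trans jk).
have nc : beta b != beta b'.
  apply: contra nb => /eqP E; apply/eqP; apply: inj.
  by rewrite /= E Eb Eb'.
apply: (concise_separates cX nc) => k.
(* The agreement over N * N steps covers a common period m. *)
pose m := order nx (beta b) * order nx (beta b').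
have m0 : 0 < m by rewrite muln_gt0 !order_gt0.
have mN : k %% m < N * N.
  by apply: leq_trans (ltn_pmod k m0) _; apply: leq_mul; apply: max_card.
rewrite -(iter_mod_mult (cB X) (m := m) k); last exact: dvdn_mulr.
rewrite -(iter_mod_mult (cB X) (m := m) k (c := beta b')); last exact: dvdn_mull.
by rewrite (Hk b) // (Hk b').
Qed.

(** A dart is recovered from the branch vertex at which its segment ends and the
   distance to it. *)
Lemma darts_bound :
  #|dart (skel W)| <= N * N * (3 * (#|dart (skel W)| - 2 * #|vertex (skel W)|)).
Proof.
have nl : ~ low_valence W by move=> l; apply: rW; constructor 1.
apply: leq_trans (leq_mul (leqnn _) (branch_bound nl)).
pose k d := ex_minn (short_segments d).
have kP d : [/\ k d < N * N, valence (tgt (iter (k d) nx d)) != 2 &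
    forall j, j < k d -> valence (tgt (iter j nx d)) = 2].
  rewrite /k; case: ex_minnP => i /andP[iN vi] mi; split=> // j ji.
  apply/eqP/negPn/negP => vj; have := mi j; rewrite vj (ltn_trans ji iN).
  by move=> /(_ isT); rewrite leqNgt ji.
pose g d : 'I_(N * N) * dart (skel W) :=
  (Ordinal (let: And3 h _ _ := kP d in h), inv (iter (k d) nx d)).
have gI : injective g.
  move=> d e [Ek /(can_inj (@invK _)) E].
  have [_ _ Hd] := kP d; have [_ _ He] := kP e.
  by apply: (iter_next_inj (n := k d)) => //; [rewrite Ek|rewrite [in RHS]Ek].
have : [set g d | d in [set: dart (skel W)]] \subset
    finset.setX [set: 'I_(N * N)] [set d : dart (skel W) | 2 < valence (src d)].
  apply/fintype.subsetP => _ /imsetP[d _ ->]; rewrite !inE /=.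
  have [_ v2 _] := kP d; have := valence_gt1 (tgt (iter (k d) nx d)) nl.
  by rewrite src_inv; move: v2; case: (valence _) => [|[|[|]]].
by move/subset_leq_card; rewrite card_imset // cardsX !cardsT card_ord.
Qed.

End Segments.

Lemma area_bound (X Y : complex) (phi : morphism Y X) : standard X ->
  total_area Y <= #|dart (bdry Y)|.
Proof.
move=> sX; rewrite card_bdry; apply: leq_sum => f _.
by rewrite (mor_area phi) (mor_perimeter phi) sX leq_mul2l perimeter_gt0 orbT.
Qed.

(** The constant only depends on X, and the last factor is -2 times the Euler
   characteristic of the 1-skeleton of Y, which is the same as that of its
   visibly irreducible model W. The area of Y is at most the number of sides of
   its faces, each of which is given by an edge of W and a side of a face of X. *)
Lemma area_gap (X Y : complex) (phi : morphism Y X) :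
  standard X -> concise X -> essential phi -> irreducible Y ->
  total_area Y <= 3 * #|dart (bdry X)| ^ 3 *
    (#|dart (skel Y)| - 2 * #|vertex (skel Y)|).
Proof.
move=> sX cX ephi [W [psi [ee [rW _]]]].
pose F := comp_map (mor_skel phi) (mor_skel psi).
pose beta := comp_map (mor_bdry phi) (mor_bdry psi).
have Ib : immersion beta.
  move=> b b' E H; apply: (@mor_bdry_immersion _ _ psi) => //.
  by apply: (@mor_bdry_immersion _ _ phi); rewrite // !gm_src E.
have FE b : F (att W b) = att X (beta b) by rewrite /= !mor_att.
have inj : injective (fun b => (att W b, beta b)).
  move=> b b' [E1 E2]; apply: (bij_inj (essential_equivalence_bdry ee)).
  by apply: (essential_injective ephi); rewrite /= -!mor_att E1 E2.
have := darts_bound cX rW Ib FE inj.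
have -> : #|dart (skel W)| - 2 * #|vertex (skel W)| =
          #|dart (skel Y)| - 2 * #|vertex (skel Y)|.
  by have := essential_equivalence_euler ee; lia.
set D := _ - _ => HD.
apply: leq_trans (area_bound phi sX) _.
rewrite -(bij_eq_card (essential_equivalence_bdry ee)).
have : #|dart (bdry W)| <= #|dart (skel W)| * #|dart (bdry X)|.
  by rewrite -card_prod; apply: leq_card inj.
move=> /leq_trans; apply.
apply: leq_trans (leq_mul HD (leqnn _)) _.
by rewrite !expnS expn0; apply: eq_leq; lia.
Qed.

(** * Surfaces are irreducible *)

Lemma inj_surj_bij (S T : choiceType) (f : S -> T) :
  injective f -> (forall y, exists x, f x = y) -> bijective f.
Proof.
move=> fI fS; have fS' y : exists x, f x == y by have [x <-] := fS y; exists x.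
have K y : f (xchoose (fS' y)) = y by apply/eqP/(xchooseP (fS' y)).
by exists (fun y => xchoose (fS' y)) => // x; apply: fI; rewrite K.
Qed.

Lemma valence_dart (G : graph) (v : vertex G) :
  0 < valence v -> exists d, src d = v.
Proof. by case/card_gt0P => d; rewrite inE => /eqP; exists d. Qed.

(** An immersion of circles that is bijective on darts is bijective on vertices. *)
Lemma circles_vertex_bij (A B : graph) (f : graph_map A B) :
  (forall v : vertex A, valence v = 2) -> (forall v : vertex B, valence v = 2) ->
  immersion f -> bijective f -> bijective (gm_vertex f).
Proof.
move=> cA cB If [g fK gK]; apply: inj_surj_bij => [u v E|w]; last first.
  have [|b <-] := @valence_dart _ w; first by rewrite cB.
  by exists (src (g b)); rewrite -gm_src gK.
have [|a Ea] := @valence_dart _ u; first by rewrite cA.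
have [|b Eb] := @valence_dart _ v; first by rewrite cA.
subst u v; have [/eqP/(can_inj fK)->//|ne] := boolP (f a == f b).
have : f a = next (inv (f b)).
  apply: (circle_next_uniq cB); first by rewrite tgt_inv !gm_src.
  by rewrite invK.
rewrite -gm_inv -map_next ?cA ?cB // => /(can_inj fK) ->.
by rewrite src_next tgt_inv.
Qed.

Definition id_map (G : graph) : graph_map G G :=
  @GraphMap G G id id (fun=> erefl) (fun=> erefl).

Definition id_morphism (X : complex) : morphism X X :=
  @Morphism X X (id_map _) (id_map _) id (fun=> 1) (fun _ _ _ E => E)
    (fun=> erefl) (fun=> erefl) (fun f => esym (mul1n _)) (fun f => esym (mul1n _)).

Lemma id_isomorphism (X : complex) : isomorphism (id_morphism X).
Proof. by split; exists id. Qed.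

Lemma id_homotopy_equivalence (G : graph) : homotopy_equivalence (id_map G).
Proof.
have H : @maps_homotopic G G id id (fun d => [:: d]) (fun d => [:: d]).
  by exists (fun=> [::]); split=> [v|d] /=; [apply: eqxx|apply: ph_refl].
exists id, (fun d => [:: d]); split=> //=.
by move=> d; rewrite !eqxx.
Qed.

Lemma immersion_fold_vertex (A B : graph) (f : graph_map A B) u v :
  immersion f -> fold_vertex f u v -> u = v.
Proof.
move=> If; elim=> {u v} // [u v w _ -> _ ->//|d d' _ E Ed].
by rewrite (If _ _ E Ed).
Qed.

(** A branched immersion is its own folding: the components of the fibre
   product through which an attaching circle factors consist of the darts
   coming from this circle, because both factors are immersions. *)
Lemma immersed_essential_folding (Y X : complex) (phi : morphism Y X) :
  immersion (mor_skel phi) ->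
  injective (fun b => (att Y b, mor_bdry phi b)) ->
  essential_folding phi (id_morphism Y) phi.
Proof.
move=> If inj; split; [|exact: id_homotopy_equivalence|by exists id|by []].
split=> //=.
  split=> //=.
  - by split=> [w|e]; [exists w|exists e].
  - move=> u v; split=> [->|]; first exact: fold_refl.
    exact: immersion_fold_vertex.
  - move=> d d'; split=> [->|[/(immersion_fold_vertex If) E Ed]].
      by split=> //; apply: fold_refl.
    exact: If E Ed.
move=> p; split=> [[b Eb]|[b [q [Eq]]]].
  by exists b, p; split=> //; apply: connect0.
pose P := [pred p : dart (fibre_product (mor_skel phi) (att X)) |
  [exists b, val p == (att Y b, mor_bdry phi b)]].
suff cl : fingraph.closed [rel d d' : dart (fibre_product (mor_skel phi) (att X)) |
    (src d == src d') || (d' == inv d)] P.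
  move=> /(closed_connect cl); have -> : q \in P by apply/existsP; exists b; apply/eqP/Eq.
  by move=> /esym/existsP[b' /eqP]; exists b'.
apply: intro_closed.
  apply: sym_connect_sym => x y /=; rewrite eq_sym; congr (_ || _).
  by apply/eqP/eqP => ->; rewrite fib_invK.
move=> {b q Eq} [[d c] /= Hx] [[d' c'] /= Hy].
case/orP=> [/eqP E|/eqP E] /existsP /= [b /eqP [Ed Ec]].
  move: E => [E1 E2]; subst d c; have /= Hy' := eqP Hy.
  have [Ec|ne] := eqVneq c' (mor_bdry phi b).
    apply/existsP; exists b; apply/eqP; rewrite /= Ec; congr (_, _).
    apply: If; first by rewrite E1.
    by rewrite Hy' mor_att Ec.
  have Ec : c' = mor_bdry phi (next (inv b)).
    rewrite map_next ?bdry_circles //; last exact: mor_bdry_immersion.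
    rewrite gm_inv; apply: (circle_next_uniq (@bdry_circles X)).
      by rewrite tgt_inv -E2.
    by rewrite invK.
  apply/existsP; exists (next (inv b)); apply/eqP; rewrite /= Ec; congr (_, _).
  apply: If; first by rewrite -E1 !gm_src src_next tgt_inv.
  by rewrite Hy' mor_att Ec.
move: E => [E1 E2]; apply/existsP; exists (inv b); apply/eqP.
by rewrite /= E1 E2 Ed Ec !gm_inv.
Qed.

Lemma id_essential_equivalence (X : complex) :
  essential_equivalence (id_morphism X).
Proof.
exists X, (id_morphism X), (id_morphism X); split; last exact: id_isomorphism.
by apply: immersed_essential_folding => [//|b b' [_ ->]].
Qed.

Section Surface.
Variable Y : complex.
Hypothesis sY : surface Y.

Lemma surface_link_degree (d : dart (skel Y)) : #|[set b | att Y b == d]| = 2.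
Proof. by have [_ _ H] := sY (src d); apply: H. Qed.

Lemma surface_side (d : dart (skel Y)) : exists b, att Y b = d.
Proof.
have : 0 < #|[set b | att Y b == d]| by rewrite surface_link_degree.
by case/card_gt0P => b; rewrite inE => /eqP; exists b.
Qed.

Lemma surface_visibly_reducible : ~ visibly_reducible Y.
Proof.
case=> [[v]|[v]|[d]].
- rewrite leqNgt => /negP; apply; have [[d Ed] _ _] := sY v; subst v.
  have [b Eb] := surface_side d.
  apply/card_gt1P; exists d, (att Y (next (inv b))).
  split; rewrite ?inE //.
    by rewrite gm_src src_next tgt_inv -gm_src Eb.
  apply/eqP => E; have /eqP := circle_next_neq (@bdry_circles Y) (inv b).
  apply; rewrite invK; apply: (@att_immersion Y).
    by rewrite src_next tgt_inv.
  by rewrite -E.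
- by have [_ nd _] := sY v.
- by rewrite /free_edge surface_link_degree.
Qed.

Variables (W : complex) (phi : morphism W Y).
Hypotheses (nl : ~ low_valence W) (ee : essential_equivalence phi).
Local Notation f := (mor_skel phi).

Let bB : bijective (mor_bdry phi) := essential_equivalence_bdry ee.

Lemma lift_side b : exists x, mor_bdry phi x = b.
Proof. by have [g _ gK] := bB; exists (g b). Qed.

Lemma card_sides d : #|[set x | f (att W x) == d]| = 2.
Proof.
rewrite -(surface_link_degree d) -(card_imset _ (bij_inj bB)).
congr #|pred_of_set _|; apply/setP=> b; apply/imsetP/idP => [[x]|].
  by rewrite !inE mor_att => Hx ->.
by have [x <-] := lift_side b; rewrite inE => H; exists x; rewrite // inE mor_att.
Qed.

(** The sum of all faces of the surface Y is a cycle modulo 2, so the sum of all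
   faces of W is one too. *)
Lemma even_sides d : ~~ odd #|[set x | att W x == d]|.
Proof.
have [Z [phi0 [phi1 [[[[[_ E] _ _ _ _] _ _ _] he _ _] [_ b1 _ _ _]]]]] := ee.
apply: (even_lift he (@bdry_circles W)) => e.
rewrite (_ : [set x | _] = [set x | f (att W x) == mor_skel phi1 e]).
  by rewrite card_sides.
by apply/setP=> x; rewrite !inE E (inj_eq (bij_inj b1)).
Qed.

(** Each edge of Y has two sides, and those lifted to an edge of W are even in
   number, so that both lie on the same edge of W. *)
Lemma side_unique x y : f (att W x) = f (att W y) -> att W x = att W y.
Proof.
move=> E; have sub : [set z | att W z == att W x] \subset
    [set z | f (att W z) == f (att W x)].
  by apply/fintype.subsetP => z; rewrite !inE => /eqP->.
have : y \in [set z | f (att W z) == f (att W x)] by rewrite inE E.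
suff /eqP <- : [set z | att W z == att W x] == [set z | f (att W z) == f (att W x)].
  by rewrite inE => /eqP.
rewrite eqEcard sub card_sides.
have : 0 < #|[set z | att W z == att W x]|.
  by apply/card_gt0P; exists x; rewrite inE.
by have := even_sides (att W x); case: #|_| => [|[]].
Qed.

(** The link of a vertex of Y is connected, and lifts to W one edge after the
   other. *)
Lemma corner_unique x y : gm_vertex f (src (att W x)) = gm_vertex f (src (att W y)) ->
  src (att W x) = src (att W y).
Proof.
move=> E; have [_ nd _] := sY (gm_vertex f (src (att W x))).
have : connect (@link_adj Y) (f (att W x)) (f (att W y)).
  apply: contra_notT nd => nc; exists (f (att W x)), (f (att W y)).
  by split=> //; rewrite [LHS]gm_src ?E.
case/connectP => p; move Ed : (f (att W x)) => d.
elim: p d x Ed {E nd} => [|e p IH] d x Ed /=.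
  by move=> _; rewrite -Ed => /esym/side_unique->.
case/andP=> /existsP[b1 /existsP[b2 /and4P[_ /eqP Eb /eqP E1 /eqP E2]]] Hp Hl.
have [x1 Ex1] := lift_side b1; have [x2 Ex2] := lift_side b2.
rewrite (@side_unique x x1); last by rewrite Ed -E1 -Ex1 mor_att.
rewrite gm_src (_ : src x1 = src x2); last first.
  apply: (bij_inj (circles_vertex_bij (@bdry_circles W) (@bdry_circles Y)
    (@mor_bdry_immersion _ _ phi) bB)).
  by rewrite -!gm_src Ex1 Ex2.
rewrite -gm_src; apply: (IH e) => //.
by rewrite -E2 -Ex2 mor_att.
Qed.

(** Let U be the set of darts of W that have sides and V the set of their
   origins. They map bijectively onto the darts and the vertices of Y, so by
   equality of the Euler characteristics W has twice as many further darts as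
   further vertices. As these vertices have valence at least 2 and all their
   darts are outside U, they are the origins of all the darts outside U, which
   disconnects V from its complement. Since W and Y have the same components,
   the complement is empty. *)
Lemma all_sides (d : dart (skel W)) : exists x, att W x = d.
Proof.
pose U := [set att W x | x : dart (bdry W)].
pose V := [set src d | d in U].
have fUI : {in U &, injective f}.
  by move=> _ _ /imsetP[x _ ->] /imsetP[y _ ->]; apply: side_unique.
have UV e : e \in U -> src e \in V by move=> Ue; apply/imsetP; exists e.
have fVI : {in V &, injective (gm_vertex f)}.
  move=> _ _ /imsetP[_ /imsetP[x _ ->] ->] /imsetP[_ /imsetP[y _ ->] ->].
  exact: corner_unique.
have fU e : exists2 e', e' \in U & f e' = e.
  have [b <-] := surface_side e; have [x <-] := lift_side b.
  by exists (att W x); [apply/imsetP; exists x|rewrite mor_att].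
have fV v : exists2 u, u \in V & gm_vertex f u = v.
  have [[e <-] _ _] := sY v; have [e' Ue' <-] := fU e.
  by exists (src e'); [apply: UV|rewrite gm_src].
have cU : #|U| = #|dart (skel Y)|.
  rewrite -(card_in_imset fUI); apply: eq_card => e; rewrite [RHS]inE.
  by have [e' Ue' <-] := fU e; apply/imsetP; exists e'.
have cV : #|V| = #|vertex (skel Y)|.
  rewrite -(card_in_imset fVI); apply: eq_card => v; rewrite [RHS]inE.
  by have [u Vu <-] := fV v; apply/imsetP; exists u.
have Ui e : (inv e \in U) = (e \in U).
  have H e' : e' \in U -> inv e' \in U.
    by move=> /imsetP[x _ ->]; apply/imsetP; exists (inv x); rewrite // gm_inv.
  by apply/idP/idP => /H; rewrite ?invK.
(* The count of the darts outside U forces equality in this inclusion. *)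
have nUV : [set e | src e \notin V] = ~: U.
  apply/eqP; rewrite eqEcard; apply/andP; split.
    by apply/fintype.subsetP => e; rewrite !inE; apply: contra; apply: UV.
  have := essential_equivalence_euler ee; rewrite -cU -cV.
  have := cardsC U; have := cardsC V.
  rewrite -(@sum_valence (skel W) (fun v => v \notin V)).
  have : \sum_(v | v \notin V) 2 <= \sum_(v | v \notin V) valence v.
    by apply: leq_sum => v _; apply: valence_gt1.
  rewrite sum_nat_const (_ : #|[pred v | v \notin V]| = #|~: V|); last first.
    by apply: eq_card => v; rewrite !inE.
  by lia.
have VU e : (src e \in V) = (e \in U).
  by move/setP/(_ e): nUV; rewrite !inE => /negb_inj.
have Vall v : v \in V.
  have [u Vu E] := fV (gm_vertex f v).
  have [Z [phi0 [phi1 [[[[[Ev _] _ _ _ _] _ _ _] he _ _] [b1 _ _ _ _]]]]] := ee.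
  have E0 : gm_vertex (mor_skel phi0) u = gm_vertex (mor_skel phi0) v.
    by apply: (bij_inj b1); rewrite -!Ev.
  suff H e : (src e \in V) = (tgt e \in V).
    by rewrite -(homotopy_equivalence_component (W := fun v => v \in V) he H E0).
  by rewrite -src_inv !VU Ui.
by have := Vall (src d); rewrite VU => /imsetP[x _ ->]; exists x.
Qed.

(** A surface cannot be unfolded. *)
Lemma surface_rigid : isomorphism phi.
Proof.
have bV := circles_vertex_bij (@bdry_circles W) (@bdry_circles Y)
  (@mor_bdry_immersion _ _ phi) bB.
have [Z [phi0 [phi1 [[[_ [_ E] _ _] _ f0 _] [_ _ _ _ f1]]]]] := ee.
split=> //.
- apply: inj_surj_bij => [u v|v].
    have [|d <-] := @valence_dart _ u; first exact/ltnW/valence_gt1.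
    have [|e <-] := @valence_dart _ v; first exact/ltnW/valence_gt1.
    have [x <-] := all_sides d; have [y <-] := all_sides e.
    exact: corner_unique.
  have [[d <-] _ _] := sY v; have [b <-] := surface_side d.
  by have [x <-] := lift_side b; exists (src (att W x)); rewrite -gm_src mor_att.
- apply: inj_surj_bij => [d e|d].
    have [x <-] := all_sides d; have [y <-] := all_sides e.
    exact: side_unique.
  have [b <-] := surface_side d; have [x <-] := lift_side b.
  by exists (att W x); rewrite mor_att.
- apply: eq_bij (bij_comp f1 f0) _ _ => a /=.
  have [b <-] := face_of_surj a.
  by rewrite -!mor_face_of E.
Qed.

End Surface.

Lemma surface_irreducible (Y : complex) : surface Y -> irreducible Y.
Proof.
move=> sY; exists Y, (id_morphism Y); split; first exact: id_essential_equivalence.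
split; first exact: surface_visibly_reducible.
by move=> W phi nl ee; apply: surface_rigid.
Qed.

(** * Twin sides in a complex that is not concise *)

Section Twins.
Variable X : complex.
Local Notation nx := (@next (bdry X)).
Implicit Types c : dart (bdry X).

Let cB := @bdry_circles X.
Let nI := circle_next_inj cB.

(** The word read along the attaching circle of c, starting with c. *)
Definition boundary_word c : seq (dart (skel X)) := map (att X) (orbit nx c).

Lemma size_boundary_word c : size (boundary_word c) = order nx c.
Proof. by rewrite size_map size_orbit. Qed.

Lemma boundary_word_neq0 c : boundary_word c != [::].
Proof. by rewrite -size_eq0 size_boundary_word -lt0n order_gt0. Qed.

Lemma boundary_word_cycle c : cycle (@no_backtrack (skel X)) (boundary_word c).
Proof.
rewrite cycle_map; apply: sub_cycle (cycle_orbit nI c) => x y /= /eqP <-.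
rewrite /no_backtrack -gm_inv; apply/eqP => /(@att_immersion X).
rewrite src_next => /(_ erefl)/eqP.
by rewrite (negbTE (circle_next_neq cB x)).
Qed.

Lemma rot_orbit i c : i < order nx c -> rot i (orbit nx c) = orbit nx (iter i nx c).
Proof.
move=> Hi; have H : iter i nx c \in orbit nx c by rewrite -fconnect_orbit fconnect_iter.
rewrite (orbitE (cycle_orbit nI c) (orbit_uniq nx c) H).
by rewrite -[index _ _]/(findex nx c _) findex_iter.
Qed.

Lemma boundary_cycle_orbit (f : face X) s : boundary_cycle f s ->
  exists c, face_of c = f /\ s = orbit nx c.
Proof.
case; case: s => // c t _ /andP[cs us] Hf; exists c.
have fc : fcycle nx (c :: t).
  apply: sub_cycle cs => x y /= /andP[/eqP Ey ne].
  by rewrite -(circle_next_uniq cB Ey ne).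
split; first by apply: Hf; rewrite mem_head.
by rewrite (orbitE fc us (mem_head _ _)) /= eqxx rot0.
Qed.

(** Two sides c, c' of faces that read the same periodic word along circles of
   the same length. They may lie on the same face. *)
Definition twins c c' := [/\ c != c', order nx c = order nx c' &
  forall k, att X (iter k nx c) = att X (iter k nx c')].

Lemma boundary_word_mkseq c :
  boundary_word c = mkseq (fun k => att X (iter k nx c)) (order nx c).
Proof. by rewrite /boundary_word /orbit traject_mkseq /mkseq -map_comp. Qed.

Lemma boundary_word_eq c c' : boundary_word c = boundary_word c' ->
  order nx c = order nx c' /\
  forall k, att X (iter k nx c) = att X (iter k nx c').
Proof.
move=> E; have En := congr1 size E; rewrite !size_boundary_word in En.
split=> // k; rewrite -(iter_mod_order cB k c) -(iter_mod_order cB k c') -En.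
set j := k %% _; have Hj : j < order nx c by rewrite ltn_pmod ?order_gt0.
have := congr1 (fun w => nth (att X c) w j) E.
by rewrite !boundary_word_mkseq -En !nth_mkseq.
Qed.

Lemma rot_boundary_word i c :
  exists2 j, boundary_word (iter j nx c) = rot i (boundary_word c) &
  (0 < i < order nx c -> iter j nx c != c).
Proof.
have [Hi|Hi] := ltnP i (order nx c); last first.
  exists 0; first by rewrite rot_oversize ?size_boundary_word.
  by case/andP=> _ H; exfalso; lia.
exists i; first by rewrite /boundary_word -rot_orbit // map_rot.
case: i Hi => // i Hi _; apply/eqP => E.
by have := findex_iter Hi; rewrite E findex0.
Qed.

Lemma not_concise_twins : ~ concise X -> exists c c', twins c c'.
Proof.
move/contrapT => [[f [f' [s [s' [nf bs bs' H]]]]]|[f [s [bs H]]]].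
  have [c [Ec Es]] := boundary_cycle_orbit bs.
  have [c' [Ec' Es']] := boundary_cycle_orbit bs'; subst s s'.
  have [i Ei] := freely_homotopic_rot (boundary_word_neq0 c) (boundary_word_neq0 c')
    (boundary_word_cycle c) (boundary_word_cycle c') H.
  have [j Ej _] := rot_boundary_word i c'.
  exists c, (iter j nx c').
  have [E1 E2] := @boundary_word_eq c (iter j nx c') (etrans Ei (esym Ej)).
  split=> //; apply: contra_notN nf => /eqP E; rewrite -Ec E -Ec'.
  exact/esym/face_of_component/same_component_iter.
have [c [Ec Es]] := boundary_cycle_orbit bs; subst s.
have [i [i0 Hi Ei]] := proper_power_rot (boundary_word_neq0 c) (boundary_word_cycle c) H.
have [j Ej nj] := rot_boundary_word i c.
exists c, (iter j nx c).
have [E1 E2] := @boundary_word_eq c (iter j nx c) (esym (etrans Ej Ei)).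
by split=> //; rewrite eq_sym nj // i0 -size_boundary_word.
Qed.

End Twins.

(** * The sphere made of a circle and two faces *)

Section CycleGraph.
Variables (T : finType) (s s' : T -> T).
Hypotheses (sK : cancel s s') (s'K : cancel s' s).

Definition cycle_src (d : T * bool) : T := if d.2 then d.1 else s d.1.
Definition cycle_inv (d : T * bool) : T * bool := (d.1, ~~ d.2).
Fact cycle_invK : involutive cycle_inv.
Proof. by case=> t b; rewrite /cycle_inv /= negbK. Qed.
Fact cycle_inv_neq d : cycle_inv d != d.
Proof. by case: d => t []; rewrite xpair_eqE andbF. Qed.

(** The graph with an edge from t to s t for each t in T, where s is a
   permutation: the disjoint union of the cycles of s. The dart (t, true) runs
   from t to s t and (t, false) is its inverse. *)
Definition cycle_graph : graph := Graph cycle_src cycle_invK cycle_inv_neq.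

Lemma cycle_graph_valence (v : vertex cycle_graph) : valence v = 2.
Proof.
rewrite /valence (_ : [set d | _] = [set (v, true); (s' v, false)]).
  by rewrite cards2 xpair_eqE andbF.
apply/setP=> -[t b]; rewrite !inE !xpair_eqE /= /cycle_src.
case: b; rewrite ?andbT ?andbF ?orbF //=.
by apply/eqP/eqP => [<-|->].
Qed.

Variables (H : graph) (g : T -> dart H).
Hypothesis gs : forall t, src (g (s t)) = tgt (g t).

Definition cycle_dart (d : T * bool) : dart H := if d.2 then g d.1 else inv (g d.1).
Fact cycle_map_src (d : dart cycle_graph) : src (cycle_dart d) = src (g (src d)).
Proof. by case: d => t []; rewrite //= /cycle_src /= gs. Qed.
Fact cycle_map_inv (d : dart cycle_graph) : cycle_dart (inv d) = inv (cycle_dart d).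
Proof. by case: d => t []; rewrite //= /cycle_dart /= invK. Qed.
(** The map that sends the edge at t to g t. *)
Definition cycle_map : graph_map cycle_graph H :=
  GraphMap (gm_vertex := fun t : vertex cycle_graph => src (g t))
    cycle_map_src cycle_map_inv.

Lemma cycle_map_immersion : (forall t, g (s t) != inv (g t)) -> immersion cycle_map.
Proof.
move=> nb [t b] [u c] /=; rewrite /cycle_src /cycle_dart /=.
case: b; case: c => // E.
- by rewrite E.
- by rewrite E => /eqP; rewrite (negbTE (nb u)).
- by rewrite -E => /eqP; rewrite eq_sym (negbTE (nb t)).
- by rewrite (can_inj sK E).
Qed.

End CycleGraph.

Section Sphere.
Variable n : nat.
Hypothesis n0 : 0 < n.

(** The circle of length n; it is a loop when n = 1. *)
Definition circle : graph := @cycle_graph 'I_n (@ordS n).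

(** The rotation of two circles; the boolean is the number of the circle. *)
Definition two_ordS (p : 'I_n * bool) : 'I_n * bool := (ordS p.1, p.2).
Definition two_ord_pred (p : 'I_n * bool) : 'I_n * bool := (ord_pred p.1, p.2).
Lemma two_ordSK : cancel two_ordS two_ord_pred.
Proof. by case=> i f; rewrite /two_ord_pred /two_ordS /= ordSK. Qed.
Lemma two_ord_predK : cancel two_ord_pred two_ordS.
Proof. by case=> i f; rewrite /two_ord_pred /two_ordS /= ord_predK. Qed.
Definition two_circles : graph := cycle_graph two_ordS.

Definition sphere_att : graph_map two_circles circle :=
  @cycle_map _ two_ordS circle (fun p => (p.1, true)) (fun=> erefl).

Definition sphere_face (d : dart two_circles) : bool := d.1.2.

Lemma iter_ordS (i j : 'I_n) : exists k, iter k (@ordS n) i = j.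
Proof.
exists (n - i + j); apply: val_inj => /=.
have H k : val (iter k (@ordS n) i) = (i + k) %% n.
  elim: k => [|k IH] /=; first by rewrite addn0 modn_small.
  by rewrite IH -addn1 modnDml addn1 addnS.
by rewrite H addnA subnKC ?(ltnW (ltn_ord i)) // modnDl modn_small.
Qed.

Fact sphere_face_of_component (b b' : dart two_circles) :
  sphere_face b = sphere_face b' <-> same_component b b'.
Proof.
split=> [E|/connectP[p]].
  have i1 (x : dart two_circles) : @same_component two_circles x (x.1, true).
    case: x => t []; first exact: connect0.
    by apply: connect1; rewrite /= /cycle_inv eqxx orbT.
  have i2 (x : dart two_circles) : @same_component two_circles (x.1, true) x.
    case: x => t []; first exact: connect0.
    by apply: connect1; rewrite /= /cycle_inv eqxx orbT.
  apply: connect_trans (i1 b) (connect_trans _ (i2 b')).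
  move: b b' E => [[i f] o] [[j f'] o']; rewrite /sphere_face /= => <-.
  have [k <-] := iter_ordS i j; elim: k => [|k IH]; first exact: connect0.
  apply: connect_trans IH _.
  apply: (@connect_trans _ _ ((iter k (@ordS n) i, f), false)); apply: connect1 => /=.
    by rewrite /cycle_inv eqxx orbT.
  by rewrite /cycle_src /= eqxx.
elim: p b => [|c p IH] b /=; first by move=> _ ->.
case/andP=> Hc Hp Hl; rewrite -(IH _ Hp Hl).
case/orP: Hc => [/eqP|/eqP->//]; move: b c {IH Hp Hl} => [[i f] o] [[j f'] o'].
by rewrite /sphere_face /= /cycle_src; case: o; case: o' => -[_ ->].
Qed.

Fact sphere_face_surj (f : bool) : exists b, sphere_face b = f.
Proof. by exists ((Ordinal n0, f), true). Qed.

Fact sphere_att_immersion : immersion sphere_att.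
Proof. by apply: (cycle_map_immersion two_ordSK) => p; rewrite xpair_eqE andbF. Qed.

Fact sphere_area_gt0 : 0 < \sum_(f : bool) 1.
Proof. by rewrite sum1_card card_bool. Qed.

(** Two faces attached along the same circle of length n. *)
Definition sphere : complex :=
  @Complex circle two_circles bool sphere_face sphere_att (fun=> 1)
    (cycle_graph_valence two_ordSK two_ord_predK) sphere_face_of_component
    sphere_face_surj sphere_att_immersion (fun=> isT) sphere_area_gt0.

Lemma sphere_euler : #|dart (skel sphere)| = 2 * #|vertex (skel sphere)|.
Proof. by rewrite /= card_prod card_bool mulnC. Qed.

Lemma sphere_attE (i : 'I_n) f (o : bool) : att sphere ((i, f), o) = (i, o).
Proof. by case: o. Qed.

Lemma sphere_surface : surface sphere.
Proof.
move=> v; split.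
- by exists (v, true).
- case=> [[i o] [[j o'] [/= Ed Ed' /negP]]]; apply.
  have [E|ne] := eqVneq o o'.
    subst o'; rewrite (_ : i = j) ?connect0 //.
    move: Ed Ed'; rewrite /cycle_src /=; case: o => [-> ->//|<-].
    by move=> /(can_inj (@ordSK n)).
  apply: connect1; apply/existsP; exists ((i, true), o).
  apply/existsP; exists ((j, true), o').
  rewrite !sphere_attE !eqxx !andbT xpair_eqE (negbTE ne) andbF /=.
  move: Ed Ed'; rewrite /cycle_src /two_ordS /=.
  by case: (o); case: (o') => -> ->.
- case=> i o _; rewrite /link_degree.
  rewrite (_ : [set b | _] = [set ((i, true), o); ((i, false), o)]).
    by rewrite cards2 !xpair_eqE /= andbF.
  apply/setP=> -[[j f] o']; rewrite !inE sphere_attE !xpair_eqE.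
  by case: f; rewrite ?andbT ?andbF ?orbF.
Qed.

End Sphere.

(** * The sphere spanned by a pair of twin sides *)

Section SphereMap.
Variables (X : complex) (c : bool -> dart (bdry X)) (n : nat).
Local Notation nx := (@next (bdry X)).
Hypotheses (X_standard : standard X) (c_neq : c true != c false).
Hypothesis c_order : forall f, order nx (c f) = n.
Hypothesis c_att : forall f k, att X (iter k nx (c f)) = att X (iter k nx (c true)).

Let cB := @bdry_circles X.
Let nI := circle_next_inj cB.

Fact sphere_map_gt0 : 0 < n.
Proof. by rewrite -(c_order true) order_gt0. Qed.
Local Notation Y := (sphere sphere_map_gt0).

(** The side over the i-th edge of the face f, where f is a boolean. *)
Definition corner_dart (p : 'I_n * bool) : dart (bdry X) := iter p.1 nx (c p.2).

Lemma corner_dart_next p : corner_dart (two_ordS p) = nx (corner_dart p).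
Proof.
case: p => i f; rewrite /corner_dart /=.
by have := iter_mod_order cB i.+1 (c f); rewrite c_order.
Qed.

Fact corner_dart_src p : src (corner_dart (two_ordS p)) = tgt (corner_dart p).
Proof. by rewrite corner_dart_next src_next. Qed.

Definition sphere_bdry_map : graph_map (bdry Y) (bdry X) := cycle_map corner_dart_src.

(** The image of the i-th edge; both faces give the same one, by [c_att]. *)
Definition edge_dart (i : 'I_n) : dart (skel X) := att X (corner_dart (i, true)).

Fact edge_dart_src i : src (edge_dart (ordS i)) = tgt (edge_dart i).
Proof.
rewrite /edge_dart -[(ordS i, true)]/(two_ordS (i, true)).
by rewrite gm_src corner_dart_src tgt_map.
Qed.

Definition sphere_skel_map : graph_map (skel Y) (skel X) := cycle_map edge_dart_src.

Fact sphere_bdry_immersion : immersion sphere_bdry_map.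
Proof.
apply: (cycle_map_immersion (@two_ordSK n)) => p.
by rewrite corner_dart_next circle_next_neq.
Qed.

Fact sphere_skel_immersion : immersion sphere_skel_map.
Proof.
apply: (cycle_map_immersion (@ordSK n)) => i.
rewrite /edge_dart -[(ordS i, true)]/(two_ordS (i, true)) corner_dart_next -gm_inv.
apply/eqP => /(@att_immersion X); rewrite src_next => /(_ erefl)/eqP.
by rewrite (negbTE (circle_next_neq cB _)).
Qed.

Fact sphere_map_att b : sphere_skel_map (att Y b) = att X (sphere_bdry_map b).
Proof.
case: b => [[i f] o]; rewrite sphere_attE /= /cycle_dart /= /edge_dart /corner_dart /=.
by case: o; rewrite ?gm_inv c_att.
Qed.

Definition sphere_face_map (f : face Y) : face X := face_of (c f).

Lemma face_of_inv (d : dart (bdry X)) : face_of (inv d) = face_of d.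
Proof. by apply/esym/face_of_component/connect1; rewrite /= eqxx orbT. Qed.

Fact sphere_map_face_of b : face_of (sphere_bdry_map b) = sphere_face_map (face_of b).
Proof.
case: b => [[i f] o]; rewrite /= /cycle_dart /sphere_face_map /sphere_face /=.
have E : face_of (corner_dart (i, f)) = face_of (c f).
  by apply/esym/face_of_component/same_component_iter.
by case: o; rewrite ?face_of_inv.
Qed.

Lemma corner_dart_inj f i j : corner_dart (i, f) = corner_dart (j, f) -> i = j.
Proof.
move=> E; apply: val_inj; have := congr1 (findex nx (c f)) E.
by rewrite /corner_dart /= !findex_iter ?c_order.
Qed.

(** A dart and its inverse lie in different orbits of [next]. *)
Lemma corner_dart_not_inv f i j : corner_dart (i, f) <> inv (corner_dart (j, f)).
Proof.
move=> E; set x := corner_dart (j, f) in E.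
apply: (@no_reverse _ _ (id_map (bdry X)) cB _ x x) => //.
rewrite -fconnect_orbit -E (@connect_trans _ _ (c f)) // ?fconnect_iter //.
by rewrite fconnect_sym // fconnect_iter.
Qed.

Fact sphere_map_perimeter (f : face Y) : perimeter f = 1 * perimeter (sphere_face_map f).
Proof.
rewrite mul1n /perimeter -(card_in_imset (f := sphere_bdry_map)); last first.
  move=> [[i g] o] [[j h] o']; rewrite !inE /= /sphere_face /= => /eqP-> /eqP->.
  rewrite /cycle_dart /=; case: o; case: o'.
  - by move=> /corner_dart_inj->.
  - by move=> /corner_dart_not_inv.
  - by move=> /esym/corner_dart_not_inv.
  - by move=> /(can_inj (@invK _))/corner_dart_inj->.
congr #|pred_of_set _|; apply/setP=> d; apply/imsetP/idP => [[b]|].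
  by rewrite !inE => /eqP Eb ->; rewrite sphere_map_face_of Eb.
rewrite inE => /eqP/esym/face_of_component/(same_componentP cB).
have H x : fconnect nx (c f) x -> exists i : 'I_n, corner_dart (i, f) = x.
  move=> Hx; have Hi : findex nx (c f) x < n by rewrite -(c_order f) findex_max.
  by exists (Ordinal Hi); apply: iter_findex.
case=> /H [i Ei]; [exists ((i, f), true)|exists ((i, f), false)]; rewrite ?inE //.
by rewrite /= /cycle_dart /= Ei invK.
Qed.

Fact sphere_map_area (f : face Y) : area f = 1 * area (sphere_face_map f).
Proof. by rewrite X_standard. Qed.

(** The two hemispheres are mapped to the faces of c true and c false. *)
Definition sphere_map : morphism Y X :=
  @Morphism Y X sphere_skel_map sphere_bdry_map sphere_face_map (fun=> 1)
    sphere_bdry_immersion sphere_map_att sphere_map_face_of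
    sphere_map_perimeter sphere_map_area.

(** The map is a branched immersion because c true and c false are different
   sides, even when they belong to the same face of X. *)
Lemma sphere_map_essential : essential sphere_map.
Proof.
exists Y, (id_morphism Y), sphere_map; apply: immersed_essential_folding.
  exact: sphere_skel_immersion.
move=> [[i f] o] [[j f'] o']; rewrite !sphere_attE => -[<- <-] E.
suff -> : f = f' by [].
have {}E : corner_dart (i, f) = corner_dart (i, f').
  by move: E; rewrite /= /cycle_dart; case: o => // /(can_inj (@invK _)).
have : c f = c f'.
  have inj k : injective (iter k nx) by elim: k => //= k IH x y /nI/IH.
  exact: inj E.
by case: f f' {E} c_neq => -[] // /eqP ne E; case: ne.
Qed.

End SphereMap.

(** * Curvature bounds *)

Lemma irreducible_euler (Y : complex) : irreducible Y ->
  2 * #|vertex (skel Y)| <= #|dart (skel Y)|.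
Proof.
case=> W [phi [/essential_equivalence_euler E [rW _]]].
have nl : ~ low_valence W by move=> l; apply: rW; constructor 1.
by have := leq_vertices_darts nl; lia.
Qed.

Section Curvature.
Variable R : realType.
Local Open Scope ring_scope.

Lemma kappaE (Y : complex) : kappa R Y =
  1 - (#|edges (skel Y)|%:R - #|vertex (skel Y)|%:R) / (total_area Y)%:R.
Proof.
have a0 : (total_area Y)%:R != 0 :> R by rewrite pnatr_eq0 -lt0n total_area_gt0.
rewrite /kappa /tau /euler_skel !rmorphD /= rmorphN /= -!pmulrn.
by rewrite mulrDl divff // -mulNr opprB.
Qed.

Lemma kappa_le1 (Y : complex) : irreducible Y -> kappa R Y <= 1.
Proof.
move=> /irreducible_euler; rewrite card_darts leq_pmul2l // => H.
by rewrite kappaE gerBl divr_ge0 // subr_ge0 ler_nat.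
Qed.

(** If the area of Y is at most -2k times the Euler characteristic, then its
   curvature is at most 1 - 1/(2k). *)
Lemma kappa_gap (k : nat) (Y : complex) :
  (total_area Y <= k * (#|dart (skel Y)| - 2 * #|vertex (skel Y)|))%N ->
  kappa R Y <= 1 - (2 * k%:R)^-1.
Proof.
rewrite card_darts -mulnBr => H; have a0 := total_area_gt0 Y.
have [k0 ve] : (0 < k)%N /\ (#|vertex (skel Y)| < #|edges (skel Y)|)%N.
  by rewrite -/(total_area Y) in a0; split; nia.
rewrite kappaE lerD2l lerN2 -natrB ?(ltnW ve) //.
rewrite ler_pdivlMr ?ltr0n // mulrC ler_pdivrMr; last by rewrite mulr_gt0 ?ltr0n.
by rewrite -!natrM ler_nat mulnC -mulnA mulnCA.
Qed.

Lemma sphere_kappa n (n0 : (0 < n)%N) : kappa R (sphere n0) = 1.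
Proof.
have := sphere_euler n0; rewrite card_darts => /eqP; rewrite eqn_pmul2l // => /eqP E.
by rewrite kappaE E subrr mul0r subr0.
Qed.

Lemma rho_plus_le1 (X : complex) : (rho_plus R X <= 1)%E.
Proof.
by apply: ge_ereal_sup => _ [Y [phi [_ iY ->]]]; rewrite lee_fin kappa_le1.
Qed.

Lemma sigma_plus_le_rho_plus (X : complex) : (sigma_plus R X <= rho_plus R X)%E.
Proof.
apply: ereal_sup_le => _ [Y [phi [ephi sY ->]]]; exists Y, phi; split=> //.
exact: surface_irreducible.
Qed.

Lemma concise_rho_plus (X : complex) : standard X -> concise X ->
  (rho_plus R X < 1)%E.
Proof.
move=> sX cX; pose k := (3 * #|dart (bdry X)| ^ 3)%N.
apply: (@le_lt_trans _ _ (1 - (2 * k%:R)^-1)%:E).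
  apply: ge_ereal_sup => _ [Y [phi [ephi iY ->]]]; rewrite lee_fin.
  exact: kappa_gap (area_gap sX cX ephi iY).
rewrite lte_fin ltrBlDr ltrDl invr_gt0 mulr_gt0 // ltr0n muln_gt0 expn_gt0.
rewrite orbF andTb lt0n; apply: contraTneq (total_area_gt0 X) => b0.
rewrite -eqn0Ngt sum_nat_eq0; apply/forallP => f; have [b _] := face_of_surj f.
by have := card0_eq b0 b.
Qed.

Lemma not_concise_sigma_plus (X : complex) : standard X -> ~ concise X ->
  (1 <= sigma_plus R X)%E.
Proof.
move=> sX /not_concise_twins [c [c' [ne Eo Ea]]].
pose cc f := if f then c else c'.
have c_order f : order (@next (bdry X)) (cc f) = order (@next (bdry X)) c.
  by case: f.
have c_att f k : att X (iter k (@next (bdry X)) (cc f)) =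
                 att X (iter k (@next (bdry X)) (cc true)) by case: f.
apply: ereal_sup_ubound.
exists (sphere (sphere_map_gt0 c_order)), (sphere_map sX c_order c_att); split.
- exact: sphere_map_essential.
- exact: sphere_surface.
- by rewrite sphere_kappa.
Qed.

End Curvature.

Theorem propositionC (R : realType) (X : complex)
    (X_standard : standard X) (X_irreducible : irreducible X) :
  (rho_plus R X = 1%E <-> sigma_plus R X = 1%E) /\
  (sigma_plus R X = 1%E <-> ~ concise X).
Proof.
have rho1 := rho_plus_le1 R X; have sr := sigma_plus_le_rho_plus R X.
have nc : rho_plus R X = 1%E -> ~ concise X.
  by move=> E cX; have := concise_rho_plus R X_standard cX; rewrite E ltxx.
have s1 : ~ concise X -> sigma_plus R X = 1%E.
  move=> /(not_concise_sigma_plus R X_standard) H.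
  by apply/eqP; rewrite eq_le H (le_trans sr rho1).
have r1 : sigma_plus R X = 1%E -> rho_plus R X = 1%E.
  by move=> E; apply/eqP; rewrite eq_le rho1 -E sr.
split; split=> H; first exact: s1 (nc H).
- exact: r1 H.
- exact: nc (r1 H).
- exact: s1 H.
Qed.
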